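(* Let $(V,m,b)$ be a weighted directed graph satisfying the standing assumptions (locally finite, weakly connected, $\sum_{y}b(x,y)>0$ for all $x$, and Kirchhoff's assumption). Suppose that the graph is $\chi$-complete for the symmetric conductance $b'(x,y)=\frac{b(x,y)+b(y,x)}{2}$, and that $$\exists C>0,\ \forall x\in V,\quad \frac{1}{m(x)}\sum_{y\in V_x}\frac{|b(x,y)-b(y,x)|^2}{b'(x,y)}\leq C .$$ Then the closure $\overline{\Delta}$ of the non-symmetric Laplacian $\Delta$ in $\ell^2(V,m)$ is m-sectorial.
   Context: Graph: $V$ is a countable set, $b:V\times V\to[0,\infty)$ satisfies $b(x,x)=0$ for all $x$, and $m:V\to(0,\infty)$ is a weight on vertices. For $x\in V$, $V_x=\{y\in V: b(x,y)>0\text{ or }b(y,x)>0\}$. Standing assumptions: (1) locally finite: every $V_x$ is finite; (2) weakly connected: any two vertices are joined by a finite chain of undirected edges $\{x,y\}$ (pairs with $b(x,y)>0$ or $b(y,x)>0$); (3) $\sum_{y\in V}b(x,y)>0$ for all $x\in V$; (4) Kirchhoff's assumption: $\sum_{y}b(x,y)=\sum_{y}b(y,x)$ for all $x\in V$. Function spaces: $\mathcal C_c(V)$ is the set of finitely supported functions $V\to\mathbb C$; $\ell^2(V,m)$ is the Hilbert space of $f:V\to\mathbb C$ with $\sum_x m(x)|f(x)|^2<\infty$, with scalar product $\langle f,g\rangle=\sum_x m(x)f(x)\overline{g(x)}$. Laplacian: $\Delta$ is the operator on $\ell^2(V,m)$ with domain $\mathcal C_c(V)$, $\Delta f(x)=\frac{1}{m(x)}\sum_{y\in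 V}b(x,y)(f(x)-f(y))$. It is closable and $\overline{\Delta}$ is its closure. $\chi$-completeness for $b'$: there exist an increasing sequence of finite sets $(B_n)_{n\in\mathbb N}$ with $V=\bigcup_n B_n$ and functions $\chi_n$ such that (i) $\chi_n\in\mathcal C_c(V)$, $0\le\chi_n\le1$; (ii) $\chi_n(v)=1$ for $v\in B_n$; (iii) there is $C>0$ such that for all $n\in\mathbb N$, $x\in V$, $\frac{1}{m(x)}\sum_{y\in V_x}b'(x,y)|\chi_n(x)-\chi_n(y)|^2\le C$. An operator $A$ with domain $D(A)$ is accretive if $\operatorname{Re}\langle Af,f\rangle\ge 0$ for all $f\in D(A)$. An accretive operator $A$ is m-accretive if the open left half-plane is contained in its resolvent set and $\|(A+\lambda)^{-1}\|\le \frac{1}{\operatorname{Re}\lambda}$ for all $\lambda$ with $\operatorname{Re}\lambda>0$. The numerical range of $A$ is $W(A)=\{\langle Af,f\rangle: f\in D(A),\ \|f\|=1\}$. $A$ is sectorial with vertex $a\in\mathbb R$ and semi-angle $\theta\in[0,\pi/2)$ if $W(A)\subset S_{a,\theta}:=\{z\in\mathbb C: |\operatorname{Im} z|\le \tan\theta\,(\operatorname{Re} z-a)\text{ and }\operatorname{Re}z\ge a\}$. $A$ is m-sectorial if, for some $a$ and $\theta$, it is sectorial with vertex $a$ and semi-angle $\theta$ and $A-a$ is m-accretive. *)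

(* Defs.v *)
From HB Require Import structures.
From mathcomp Require Import all_boot all_order all_algebra.
From mathcomp Require Import complex.
From mathcomp Require Import all_classical all_reals all_analysis.
From mathcomp Require Import ring lra.

Set Implicit Arguments.
Unset Strict Implicit.
Unset Printing Implicit Defensive.

Import Order.TTheory GRing.Theory Num.Theory.
Import numFieldNormedType.Exports.

Local Open Scope classical_set_scope.
Local Open Scope ring_scope.
Local Open Scope complex_scope.

Section absolutely_convergent_sums.
Variables (R : realType) (T : choiceType).
Implicit Types u v : T -> R.

Definition rsummable u : Prop := summable [set: T] (EFin \o u).

(* The sum of the positive part of u minus the sum of its negative part; junk
   when u is not summable. *)
Definition rsum u : R :=
  fine (esum [set: T] ((EFin \o u)^\+)%E - esum [set: T] ((EFin \o u)^\-)%E)%E.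

Definition csum (z : T -> R[i]) : R[i] :=
  rsum (fun x => complex.Re (z x)) +i* rsum (fun x => complex.Im (z x)).

Let nsum u := fine (esum [set: T] (EFin \o u)).

Lemma le_rsummable u v : (forall x, `|u x| <= v x) -> rsummable v -> rsummable u.
Proof.
move=> uv; rewrite /rsummable /summable; apply: le_lt_trans.
apply: le_esum => x _ /=; rewrite lee_fin (le_trans (uv x))//.
exact: ler_norm.
Qed.

Lemma rsummableD u v :
  rsummable u -> rsummable v -> rsummable (fun x => u x + v x).
Proof. exact: summableD. Qed.

Lemma esumZ u (c : R) : 0 <= c -> (forall x, 0 <= u x) ->
  (\esum_(x in [set: T]) (c * u x)%:E = c%:E * \esum_(x in [set: T]) (u x)%:E)%E.
Proof.
move=> c0 u0; rewrite /esum -ereal_supZl//; last first.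
  apply/set0P; exists 0%E; exists set0; first exact: fsets_set0.
  by rewrite fsbig_set0.
congr ereal_sup; rewrite image_comp; apply: eq_imagel => A _ /=.
by rewrite ge0_mule_fsumr.
Qed.

Lemma rsummableZ u (c : R) : rsummable u -> rsummable (fun x => c * u x).
Proof.
rewrite /rsummable /summable => su.
under eq_esum do rewrite /= normrM.
rewrite (@esumZ (fun x => `|u x|))//.
by rewrite lte_mul_pinfty.
Qed.

Lemma ge0_fin_num u : (forall x, 0 <= u x) -> rsummable u ->
  (\esum_(x in [set: T]) (u x)%:E)%E \is a fin_num.
Proof.
move=> u0; rewrite /rsummable summableE.
by under eq_esum do rewrite /= ger0_norm//.
Qed.

Let nsumD u v : (forall x, 0 <= u x) -> (forall x, 0 <= v x) ->
  rsummable u -> rsummable v -> nsum (fun x => u x + v x) = nsum u + nsum v.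
Proof.
move=> u0 v0 su sv; rewrite /nsum -fineD ?ge0_fin_num// -esumD//=.
- by move=> x _; rewrite lee_fin.
- by move=> x _; rewrite lee_fin.
Qed.

Let nsumZ u (c : R) : 0 <= c -> (forall x, 0 <= u x) -> rsummable u ->
  nsum (fun x => c * u x) = c * nsum u.
Proof. by move=> c0 u0 su; rewrite /nsum /= esumZ// fineM// ge0_fin_num. Qed.

Let rsum_sub u v : (forall x, 0 <= u x) -> (forall x, 0 <= v x) ->
  rsummable u -> rsummable v -> rsum (fun x => u x - v x) = nsum u - nsum v.
Proof.
move=> u0 v0 su sv; rewrite /rsum /nsum -fineB ?ge0_fin_num//; congr fine.
rewrite -(@esumB _ _ _ (EFin \o u) (EFin \o v))//.
- by move=> x _ /=; rewrite lee_fin.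
- by move=> x _ /=; rewrite lee_fin.
Qed.

Let p u := fun x => Num.max (u x) 0.
Let n u := fun x => Num.max (- u x) 0.

Let p0 u x : 0 <= p u x. Proof. by rewrite /p le_max lexx orbT. Qed.
Let n0 u x : 0 <= n u x. Proof. by rewrite /n le_max lexx orbT. Qed.

Let sp u : rsummable u -> rsummable (p u).
Proof.
rewrite /rsummable => su; apply: (@le_rsummable _ (fun x => `|u x|)).
  by move=> x; rewrite ger0_norm// /p ge_max ler_norm/=.
by apply: le_lt_trans su; apply: le_esum => x _ /=; rewrite normr_id.
Qed.

Let sn u : rsummable u -> rsummable (n u).
Proof.
rewrite /rsummable => su; apply: (@le_rsummable _ (fun x => `|u x|)).
  by move=> x; rewrite ger0_norm// /n ge_max -normrN ler_norm/=.
by apply: le_lt_trans su; apply: le_esum => x _ /=; rewrite normr_id.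
Qed.

Let pn u x : u x = p u x - n u x.
Proof. by rewrite /p /n /Num.max; do 2 case: ifPn; lra. Qed.

Let rsumE u : rsummable u -> rsum u = nsum (p u) - nsum (n u).
Proof.
move=> su; rewrite -rsum_sub//; [|exact: sp|exact: sn].
by congr rsum; apply/funext => x; exact: pn.
Qed.

Lemma rsumD u v : rsummable u -> rsummable v ->
  rsum (fun x => u x + v x) = rsum u + rsum v.
Proof.
move=> su sv; rewrite (rsumE su) (rsumE sv).
have -> : (fun x => u x + v x) =
    (fun x => (p u x + p v x) - (n u x + n v x)).
  by apply/funext => x; rewrite {1}(pn u x) {1}(pn v x); lra.
rewrite (@rsum_sub (fun x => p u x + p v x) (fun x => n u x + n v x)); last 4 first.
- by move=> x; rewrite addr_ge0.
- by move=> x; rewrite addr_ge0.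
- by apply: rsummableD; exact: sp.
- by apply: rsummableD; exact: sn.
rewrite !nsumD//; [|exact: sn|exact: sn|exact: sp|exact: sp].
lra.
Qed.

Lemma rsumZ u (c : R) : rsummable u -> rsum (fun x => c * u x) = c * rsum u.
Proof.
move=> su; rewrite !(rsumE su).
have spu := sp su; have snu := sn su.
have [c0|c0] := leP 0 c.
  have -> : (fun x => c * u x) = (fun x => c * p u x - c * n u x).
    by apply/funext => x; rewrite {1}(pn u x) mulrBr.
  rewrite (@rsum_sub (fun x => c * p u x) (fun x => c * n u x)); last 4 first.
  - by move=> x; rewrite mulr_ge0.
  - by move=> x; rewrite mulr_ge0.
  - exact: rsummableZ.
  - exact: rsummableZ.
  by rewrite !nsumZ// mulrBr.
have c0' : 0 <= - c by lra.
have -> : (fun x => c * u x) = (fun x => - c * n u x - - c * p u x).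
  by apply/funext => x; rewrite {1}(pn u x); ring.
rewrite (@rsum_sub (fun x => - c * n u x) (fun x => - c * p u x)); last 4 first.
- by move=> x; rewrite mulr_ge0.
- by move=> x; rewrite mulr_ge0.
- exact: rsummableZ.
- exact: rsummableZ.
by rewrite !nsumZ//; ring.
Qed.

Lemma rsum_ge0E u : (forall x, 0 <= u x) -> rsummable u ->
  rsum u = fine (\esum_(x in [set: T]) (u x)%:E)%E.
Proof.
move=> u0 su.
have s0 : rsummable (fun=> 0).
  by apply: (le_rsummable _ su) => x; rewrite normr0.
rewrite -[LHS]/(rsum (fun x => u x)).
under [in LHS]eq_fun do rewrite -[u _]subr0.
by rewrite rsum_sub// /nsum /= [X in _ - fine X]esum1// subr0.
Qed.

End absolutely_convergent_sums.

Record wdigraph (R : realType) (V : countType) := WDigraph {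
  edge_weight : V -> V -> R;
  vertex_weight : V -> R;
  edge_weight_ge0 : forall x y, 0 <= edge_weight x y;
  edge_weight_loop : forall x, edge_weight x x = 0;
  vertex_weight_gt0 : forall x, 0 < vertex_weight x }.

Section little_l2.
Variables (R : realType) (V : countType) (G : wdigraph R V).
Local Notation m := (vertex_weight G).
Implicit Types f g h : V -> R[i].

Definition square_summable : {pred V -> R[i]} := [pred f |
  `[< (\esum_(x in [set: V]) (m x * Normc.normc (f x) ^+ 2)%:E < +oo)%E >] ].

Record l2 := L2 { l2_fun :> V -> R[i]; _ : l2_fun \in square_summable }.

HB.instance Definition _ := [isSub for l2_fun].
HB.instance Definition _ := [Choice of l2 by <:].

Lemma normc_sqr (z : R[i]) :
  Normc.normc z ^+ 2 = complex.Re z ^+ 2 + complex.Im z ^+ 2.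
Proof. by case: z => a b /=; rewrite sqr_sqrtr// addr_ge0// sqr_ge0. Qed.

Let w f x := m x * (complex.Re (f x) ^+ 2 + complex.Im (f x) ^+ 2).

Let w_ge0 f x : 0 <= w f x.
Proof. by rewrite /w mulr_ge0 ?addr_ge0 ?sqr_ge0// ltW// vertex_weight_gt0. Qed.

Lemma square_summableP f : f \in square_summable <-> rsummable (w f).
Proof.
have -> : rsummable (w f) =
    (\esum_(x in [set: V]) (m x * Normc.normc (f x) ^+ 2)%:E < +oo)%E :> Prop.
  rewrite /rsummable /summable; congr (is_true (_ < _)%E).
  apply: eq_esum => x _ /=; rewrite normc_sqr ger0_norm//; exact: w_ge0.
by split => /asboolP.
Qed.

Lemma square_summable_submod : submod_closed square_summable.
Proof.
split=> [|c f g].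
  apply/square_summableP; rewrite /rsummable /summable esum1//= => x _.
  by rewrite /w /= !expr0n /= addr0 mulr0 normr0.
move=> /square_summableP sf /square_summableP sg; apply/square_summableP.
have := rsummableD (rsummableZ (2 * (complex.Re c ^+ 2 + complex.Im c ^+ 2)) sf)
  (rsummableZ 2 sg).
apply: (@le_rsummable R V) => x; rewrite ger0_norm ?w_ge0//.
rewrite /w -[(c *: f + g) x]/(c * f x + g x).
case: (f x) (g x) c => [a b] [a' b'] [c c'] /=.
have := vertex_weight_gt0 G x; move: (m x) => mx mx0.
rewrite -subr_ge0 [leRHS](_ : _ = mx * ((c * a - c' * b - a') ^+ 2 +
  (c * b + c' * a - b') ^+ 2)); last by ring.
by rewrite mulr_ge0 ?addr_ge0 ?sqr_ge0// ltW.
Qed.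

HB.instance Definition _ := GRing.isSubmodClosed.Build _ _ square_summable
  square_summable_submod.
HB.instance Definition _ := [SubChoice_isSubLmodule of l2 by <:].

Definition l2_dot (f g : l2) : R[i] := csum (fun x => (m x)%:C * f x * (g x)^*%R).

Let rdot (f g : V -> R[i]) x :=
  m x * (complex.Re (f x) * complex.Re (g x) + complex.Im (f x) * complex.Im (g x)).
Let idot (f g : V -> R[i]) x :=
  m x * (complex.Im (f x) * complex.Re (g x) - complex.Re (f x) * complex.Im (g x)).

Let l2_dotE (f g : l2) : l2_dot f g = rsum (rdot f g) +i* rsum (idot f g).
Proof.
rewrite /l2_dot /csum; congr Complex; congr rsum; apply/funext => x;
by rewrite /rdot /idot; case: (f x) (g x) => [a b] [c d] /=; ring.
Qed.

Let l2P (f : l2) : rsummable (w f).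
Proof. by apply/square_summableP; exact: (valP f). Qed.

Let rdot_summable (f g : l2) : rsummable (rdot f g).
Proof.
apply: le_rsummable (rsummableD (l2P f) (l2P g)) => x.
rewrite /rdot /w; case: (f x) (g x) => [a b] [c d] /=.
have := vertex_weight_gt0 G x; move: (m x) => mx mx0.
rewrite normrM gtr0_norm// -mulrDr ler_pM2l// ler_norml.
have := (sqr_ge0 (a + c), sqr_ge0 (a - c), sqr_ge0 (b + d), sqr_ge0 (b - d)).
move=> [[[]]]; rewrite !sqrrD !sqrrN => h1 h2 h3 h4.
have := (sqr_ge0 a, sqr_ge0 b, sqr_ge0 c, sqr_ge0 d) => -[[[]]] *.
by apply/andP; split; lra.
Qed.

Let idot_summable (f g : l2) : rsummable (idot f g).
Proof.
apply: le_rsummable (rsummableD (l2P f) (l2P g)) => x.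
rewrite /idot /w; case: (f x) (g x) => [a b] [c d] /=.
have := vertex_weight_gt0 G x; move: (m x) => mx mx0.
rewrite normrM gtr0_norm// -mulrDr ler_pM2l// ler_norml.
have := (sqr_ge0 (b + c), sqr_ge0 (b - c), sqr_ge0 (a + d), sqr_ge0 (a - d)).
move=> [[[]]]; rewrite !sqrrD !sqrrN => h1 h2 h3 h4.
have := (sqr_ge0 a, sqr_ge0 b, sqr_ge0 c, sqr_ge0 d) => -[[[]]] *.
by apply/andP; split; lra.
Qed.

Let l2_dot_linear (h : l2) c (f g : l2) :
  l2_dot (c *: f + g) h = c * l2_dot f h + l2_dot g h.
Proof.
rewrite !l2_dotE.
have rP := rdot_summable f h; have iP := idot_summable f h.
have -> : rdot (c *: f + g) h = fun x => (complex.Re c * rdot f h x +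
    - complex.Im c * idot f h x) + rdot g h x.
  apply/funext => x; rewrite /rdot /idot.
  rewrite -[(c *: f + g : l2) x]/(c * f x + g x).
  by case: (f x) (g x) (h x) c => [a b] [a' b'] [a2 b2] [c c'] /=; ring.
have -> : idot (c *: f + g) h = fun x => (complex.Re c * idot f h x +
    complex.Im c * rdot f h x) + idot g h x.
  apply/funext => x; rewrite /rdot /idot.
  rewrite -[(c *: f + g : l2) x]/(c * f x + g x).
  by case: (f x) (g x) (h x) c => [a b] [a' b'] [a2 b2] [c c'] /=; ring.
have rZ (t : R) := rsummableZ t rP; have iZ (t : R) := rsummableZ t iP.
rewrite (rsumD (rsummableD (rZ _) (iZ _)) (rdot_summable g h)).
rewrite (rsumD (rsummableD (iZ _) (rZ _)) (idot_summable g h)).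
rewrite (rsumD (rZ _) (iZ _)) (rsumD (iZ _) (rZ _)) !(rsumZ _ rP) !(rsumZ _ iP).
move: (rsum _) (rsum _) (rsum _) (rsum _) => r1 i1 r2 i2.
by case: c {rZ iZ} => c c'; apply/eqP; rewrite eq_complex /=; apply/andP; split;
  apply/eqP; ring.
Qed.

Let l2_dotC (f g : l2) : l2_dot f g = (l2_dot g f)^*%R.
Proof.
rewrite !l2_dotE; apply/eqP; rewrite eq_complex /=; apply/andP; split; apply/eqP.
  by congr rsum; apply/funext => x; rewrite /rdot; ring.
rewrite -mulN1r -rsumZ//; congr rsum; apply/funext => x; rewrite /idot; ring.
Qed.

Let l2_dot_bilinear :
  bilinear_for *%R (Num.conj \; *%R) (l2_dot : l2 -> l2 -> R[i]).
Proof.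
split=> [h c f g|h c f g]; first exact: l2_dot_linear.
rewrite /= (l2_dotC h) (l2_dotC h f) (l2_dotC h g) l2_dot_linear.
by rewrite rmorphD rmorphM.
Qed.

HB.instance Definition _ := bilinear_isBilinear.Build R[i] (l2 : lmodType R[i])
  (l2 : lmodType R[i]) R[i] *%R (Num.conj \; *%R) l2_dot l2_dot_bilinear.

Let l2_dot_hermitian (f g : l2) :
  l2_dot f g = (-1) ^+ false * Num.conj (l2_dot g f).
Proof. by rewrite expr0 mul1r -l2_dotC. Qed.

HB.instance Definition _ := isHermitianSesquilinear.Build R[i] l2 false Num.conj
  l2_dot l2_dot_hermitian.

Lemma l2_dotxx (f : l2) : l2_dot f f =
  (fine (\esum_(x in [set: V]) (m x * Normc.normc (f x) ^+ 2)%:E)%E)%:C.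
Proof.
rewrite l2_dotE.
have -> : rdot f f = w f by apply/funext => x; rewrite /rdot /w !expr2.
rewrite (rsum_ge0E (w_ge0 f) (l2P f)).
have -> : idot f f = fun x => 0 * w f x.
  by apply/funext => x; rewrite /idot; ring.
rewrite rsumZ// mul0r; congr Complex; congr fine.
by apply: eq_esum => x _; rewrite normc_sqr.
Qed.

Let l2_dot_gt0 (f : l2) : f != 0 -> 0 < l2_dot f f.
Proof.
move=> f0; rewrite l2_dotxx ltcR.
have [x fx0] : exists x, f x != 0.
  apply: contrapT => fx; move/eqP: f0; apply; apply/val_inj/funext => x /=.
  by apply/eqP/negPn/negP => fx0; apply: fx; exists x.
have eE : (\esum_(x in [set: V]) (m x * Normc.normc (f x) ^+ 2)%:E =
           \esum_(x in [set: V]) (w f x)%:E)%E.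
  by apply: eq_esum => y _; rewrite normc_sqr.
rewrite fine_gt0// eE; apply/andP; split; last first.
  by rewrite ltey_eq (ge0_fin_num (w_ge0 f) (l2P f)).
apply: (@lt_le_trans _ _ (w f x)%:E).
  rewrite lte_fin /w mulr_gt0 ?vertex_weight_gt0// -normc_sqr exprn_gt0//.
  rewrite lt_def; apply/andP; split; last by case: (f x) => a b; exact: sqrtr_ge0.
  by apply: contra fx0 => /eqP/Normc.eq0_normc ->.
rewrite -(@esum_set1 _ _ x (fun x => (w f x)%:E)) ?lee_fin//.
rewrite [leRHS](esumID [set x]) ?setTI ?leeDl//.
- by apply: esum_ge0 => y _; rewrite lee_fin.
- by move=> y _; rewrite lee_fin.
Qed.

HB.instance Definition _ := isDotProduct.Build R[i] l2 l2_dot l2_dot_gt0.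

End little_l2.

Arguments l2_dot {R V} G f g.

Section unbounded_operators.
Variables (R : realType) (H : lmodType R[i]) (dot : {dot H for Num.conj}).
Implicit Types (A : set (H * H)) (z : R[i]).

Definition hnorm (f : H) : R := Num.sqrt (complex.Re (dot f f)).

Definition hcvg (u : nat -> H) (f : H) : Prop :=
  hnorm (u n - f) @[n --> \oo] --> (0 : R).

(* An unbounded operator is represented by its graph: A (f, g) reads
   "f is in D(A) and A f = g". In particular A is closable exactly when
   op_closure A is again an operator. *)
Definition is_operator A : Prop :=
  [/\ A (0, 0),
      forall z p q, A p -> A q -> A (z *: p.1 + q.1, z *: p.2 + q.2) &
      forall f g h, A (f, g) -> A (f, h) -> g = h].

Definition op_dom A : set H := [set f | exists g, A (f, g)].

Definition op_closure A : set (H * H) :=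
  [set p | exists u : nat -> H * H, [/\ forall n, A (u n),
     hcvg (fst \o u) p.1 & hcvg (snd \o u) p.2]].

(* the graph of A - z *)
Definition op_sub A z : set (H * H) := [set p | A (p.1, p.2 + z *: p.1)].

Definition op_inv A : set (H * H) := [set p | A (p.2, p.1)].

Definition op_norm A : \bar R :=
  ereal_sup [set (hnorm p.2)%:E | p in A `&` [set p | hnorm p.1 <= 1]].

Definition resolvent_set A : set R[i] := [set z |
  [/\ is_operator (op_inv (op_sub A z)),
      op_dom (op_inv (op_sub A z)) = [set: H] &
      (op_norm (op_inv (op_sub A z)) < +oo)%E]].

Definition accretive A : Prop :=
  forall f g, A (f, g) -> 0 <= complex.Re (dot g f).

Definition m_accretive A : Prop :=
  [/\ is_operator A, accretive A,
      [set z | complex.Re z < 0] `<=` resolvent_set A &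
      forall z, 0 < complex.Re z ->
        (op_norm (op_inv (op_sub A (- z)%R)) <= ((complex.Re z)^-1)%R%:E)%E].

Definition numerical_range A : set R[i] :=
  [set dot p.2 p.1 | p in A `&` [set p | hnorm p.1 = 1]].

Definition sector (a theta : R) : set R[i] :=
  [set z | `|complex.Im z| <= tan theta * (complex.Re z - a) /\
           a <= complex.Re z].

Definition sectorial A (a theta : R) : Prop :=
  [/\ 0 <= theta, theta < pi / 2 & numerical_range A `<=` sector a theta].

Definition m_sectorial A : Prop :=
  is_operator A /\
  exists a theta : R, sectorial A a theta /\ m_accretive (op_sub A a%:C).

End unbounded_operators.

Section graphs.
Variables (R : realType) (V : countType) (G : wdigraph R V).
Local Notation b := (edge_weight G).
Local Notation m := (vertex_weight G).

Definition adjacent : rel V := fun x y => (0 < b x y) || (0 < b y x).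

Definition neighbors (x : V) : set V := [set y | adjacent x y].

Definition locally_finite : Prop := forall x, finite_set (neighbors x).

Definition weakly_connected : Prop :=
  forall x y, exists2 p : seq V, path adjacent x p & last x p = y.

(* Under local finiteness these sums over V have finitely many nonzero terms;
   \sum_(y \in A) is 0 by convention when there are infinitely many. *)
Definition positive_outdegree : Prop :=
  forall x, 0 < \sum_(y \in [set: V]) b x y.

Definition kirchhoff : Prop :=
  forall x, \sum_(y \in [set: V]) b x y = \sum_(y \in [set: V]) b y x.

Definition sym_weight (x y : V) : R := (b x y + b y x) / 2.

Definition finitely_supported (K : nmodType) (f : V -> K) : Prop :=
  finite_set [set x | f x != 0].

(* The sums run over the neighborhoods V_x of G, so c should be supported by
   the edges of G, as sym_weight is. *)
Definition chi_complete (c : V -> V -> R) : Prop :=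
  exists (B : nat -> set V) (chi : nat -> V -> R),
    [/\ forall n, finite_set (B n),
        forall n, B n `<=` B n.+1 &
        \bigcup_n B n = [set: V]] /\
    [/\ forall n, finitely_supported (chi n),
        forall n x, 0 <= chi n x <= 1,
        forall n x, B n x -> chi n x = 1 &
        exists2 C : R, 0 < C & forall n x,
          (m x)^-1 * \sum_(y \in neighbors x)
             c x y * `|chi n x - chi n y| ^+ 2 <= C].

Definition laplacian_fun (f : V -> R[i]) (x : V) : R[i] :=
  ((m x)^-1)%:C * \sum_(y \in [set: V]) (b x y)%:C * (f x - f y).

Definition laplacian : set (l2 G * l2 G) :=
  [set p : l2 G * l2 G |
    finitely_supported p.1 /\ (p.2 : V -> R[i]) = laplacian_fun p.1].

Lemma finitely_supported_l2 (f : V -> R[i]) :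
  finitely_supported f -> f \in square_summable G.
Proof.
move=> fS; apply/asboolP => /=.
rewrite (esumID [set x | f x != 0]); last first.
  move=> x _; rewrite lee_fin mulr_ge0 ?sqr_ge0// ltW//.
  exact: vertex_weight_gt0.
rewrite [X in (_ + X)%E]esum1 ?adde0; last first.
  by move=> x [_ /= /negP/negPn/eqP ->]; rewrite Normc.normc0 expr0n/= mulr0.
rewrite setTI esum_fset//; first by rewrite fsumEFin// ltry.
move=> x _; rewrite lee_fin mulr_ge0 ?sqr_ge0// ltW//.
exact: vertex_weight_gt0.
Qed.

(* Membership of g = Delta f in l2 is thus no restriction on the domain, which
   is all of C_c(V). *)
Lemma laplacian_dom : locally_finite ->
  op_dom laplacian = [set f | finitely_supported f].
Proof.
move=> lf; apply/seteqP; split=> f /=; first by case=> g [].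
move=> fS; suff LS : finitely_supported (laplacian_fun f).
  by exists (L2 (finitely_supported_l2 LS)).
set S := [set x | f x != 0] in fS *.
apply: (@sub_finite_set _ _ (S `|` \bigcup_(x in S) neighbors x)).
  move=> x /= /eqP Lx; apply: contrapT => /not_orP[/negP/negPn/eqP fx0 nb].
  apply: Lx; rewrite /laplacian_fun [X in _ * X]fsbig1 ?mulr0// => y _.
  rewrite fx0 sub0r; have [->|fy0] := eqVneq (f y) 0; first by rewrite oppr0 mulr0.
  suff -> : b x y = 0 by rewrite mul0r.
  apply/eqP/negPn/negP => bxy; apply: nb; exists y => //.
  by rewrite /neighbors /= /adjacent orbC lt_def bxy edge_weight_ge0.
rewrite finite_setU; split=> //; apply: bigcup_finite => // x _; exact: lf.
Qed.

End graphs.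

Arguments laplacian {R V} G _.

(* Main.v *)
Require Import Defs.
From mathcomp Require Import all_boot all_order all_algebra.
From mathcomp Require Import complex.
From mathcomp Require Import all_classical all_reals all_analysis.
From mathcomp Require Import ring lra.

Set Implicit Arguments.
Unset Strict Implicit.
Unset Printing Implicit Defensive.

Import Order.TTheory GRing.Theory Num.Theory.
Import numFieldNormedType.Exports.

Local Open Scope classical_set_scope.
Local Open Scope ring_scope.

(** Adding a real multiple of the identity to Delta makes it accretive, and an
    accretive operator has an m-accretive closure as soon as [A + z] has dense
    range for every z in the right half-plane; so everything reduces to two
    inequalities for finitely supported functions and one Hilbert space
    argument.

    Sectoriality ([laplacian_sector]).  Kirchhoff's law kills the sum of
    b(x,y) (|f(x)|^2 - |f(y)|^2), so Re <Delta f, f> is the Dirichlet energy of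
    the symmetric weight b', half the sum of b'(x,y) |f(x) - f(y)|^2.  The
    imaginary part only sees the antisymmetric part b(x,y) - b(y,x); its
    summand is at most |b(x,y) - b(y,x)| |f(x) - f(y)| |f(x)|, and the
    hypothesis on |b(x,y) - b(y,x)|^2 / b'(x,y) is what lets Cauchy-Schwarz
    split it into energy plus mass, with constant C2:
    |Im <Delta f, f>| <= Re <Delta f, f> + C2 |f|^2.

    Density of the range ([orthogonal_mass_bound]).  Let k be orthogonal to the
    range of Delta + z, and test against chi_n^2 k, which is finitely
    supported.  Commuting the cut-off with Delta costs at most
    (C1 + C2) |k|^2, where C1 is the constant of chi-completeness, and leaves a
    nonnegative energy, hence Re z |chi_n k|^2 <= (C1 + C2) |k|^2.  Since the
    sets where chi_n = 1 exhaust V, Re z |k|^2 <= (C1 + C2) |k|^2, and k = 0 when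
    Re z > C1 + C2.  Taking the vertex to be - (C1 + C2) makes this range of z
    sufficient: the error terms never have to tend to 0.

    Hilbert space argument ([m_sectorial_closure]).  By completeness of l2
    ([l2_complete]) and the projection argument
    ([dense_of_trivial_orthogonal]), every h is a limit of (Delta + z) f_n; the
    lower bound on Delta + z makes (f_n) converge, so h is in the range of the
    closure of Delta + z.  The closure is an operator because Delta acts at each
    vertex through finitely many values, so l2 limits of f_n and Delta f_n are
    still related by the pointwise formula ([op_closure_laplacian]). *)

(** * Real and imaginary parts *)

Section complex_parts.
Variable R : realType.
Implicit Types x y : R[i].

Lemma ReCD x y : complex.Re (x + y) = complex.Re x + complex.Re y.
Proof. by case: x y => a b []. Qed.

Lemma ReCN x : complex.Re (- x) = - complex.Re x.
Proof. by case: x. Qed.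

Lemma ImCD x y : complex.Im (x + y) = complex.Im x + complex.Im y.
Proof. by case: x y => a b []. Qed.

Lemma ImCN x : complex.Im (- x) = - complex.Im x.
Proof. by case: x. Qed.

Lemma ReCM x y : complex.Re (x * y) =
  complex.Re x * complex.Re y - complex.Im x * complex.Im y.
Proof. by case: x y => a b []. Qed.

Lemma ImCM x y : complex.Im (x * y) =
  complex.Re x * complex.Im y + complex.Im x * complex.Re y.
Proof. by case: x y => a b []. Qed.

Lemma ReCJ x : complex.Re (Num.conj x) = complex.Re x.
Proof. by case: x. Qed.

Lemma ImCJ x : complex.Im (Num.conj x) = - complex.Im x.
Proof. by case: x. Qed.

End complex_parts.

(** * Norm and convergence in an inner product space *)

Section inner_product.
Variables (R : realType) (H : lmodType R[i]) (dot : {dot H for Num.conj}).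
Implicit Types (f g h : H) (z : R[i]).

Local Notation nrm := (hnorm dot).
Local Notation rdot f g := (complex.Re (dot f g)).

Lemma rdotC f g : rdot f g = rdot g f.
Proof. by rewrite (hermC dot) expr0 mul1r ReCJ. Qed.

Lemma rdotDl f g h : rdot (f + g) h = rdot f h + rdot g h.
Proof. by rewrite linearDl ReCD. Qed.

Lemma rdotNl f g : rdot (- f) g = - rdot f g.
Proof. by rewrite linearNl ReCN. Qed.

Lemma rdotZl (a : R) f g : rdot (a%:C%C *: f) g = a * rdot f g.
Proof. by rewrite linearZl_LR ReCM /=; ring. Qed.

Lemma rdotDr f g h : rdot f (g + h) = rdot f g + rdot f h.
Proof. by rewrite rdotC rdotDl !(rdotC f). Qed.

Lemma rdotNr f g : rdot f (- g) = - rdot f g.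
Proof. by rewrite rdotC rdotNl rdotC. Qed.

Lemma rdotZr (a : R) f g : rdot f (a%:C%C *: g) = a * rdot f g.
Proof. by rewrite rdotC rdotZl rdotC. Qed.

Lemma rdotZxx z f : rdot (z *: f) f = complex.Re z * rdot f f.
Proof.
have : 0 <= dot f f := dnorm_ge0 dot f.
by rewrite linearZl_LR ReCM lecE /= => /andP[/eqP-> _]; ring.
Qed.

Lemma rdot_ge0 f : 0 <= rdot f f.
Proof. by have : 0 <= dot f f := dnorm_ge0 dot f; rewrite lecE => /andP[]. Qed.

(** Reduces every statement about imaginary parts, continuity in particular, to
    one about the real inner product. *)
Lemma idot_rdot f g : complex.Im (dot f g) = - rdot ('i%C *: f) g.
Proof. by rewrite linearZl_LR ReCM /=; ring. Qed.

Lemma sqr_hnorm f : nrm f ^+ 2 = rdot f f.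
Proof. by rewrite sqr_sqrtr// rdot_ge0. Qed.

Lemma hnorm_ge0 f : 0 <= nrm f. Proof. exact: sqrtr_ge0. Qed.

Lemma hnormZ z f : nrm (z *: f) = Normc.normc z * nrm f.
Proof.
apply/eqP; rewrite -(eqrXn2 (n := 2))// ?mulr_ge0 ?hnorm_ge0//; last first.
  by case: z => a b; exact: sqrtr_ge0.
rewrite exprMn !sqr_hnorm normc_sqr.
have : 0 <= dot f f := dnorm_ge0 dot f.
rewrite linearZl_LR linearZr_LR /= !ReCM ImCM ReCJ ImCJ lecE /=.
by move=> /andP[/eqP-> _]; apply/eqP; ring.
Qed.

Lemma hnorm_opp f : nrm (- f) = nrm f.
Proof. by rewrite /hnorm rdotNl rdotNr opprK. Qed.

Lemma hnorm0 : nrm 0 = 0.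
Proof. by rewrite /hnorm linear0l /= sqrtr0. Qed.

Lemma hnorm_eq0 f : nrm f = 0 -> f = 0.
Proof.
move=> f0; apply/eqP; rewrite -(dnorm_eq0 dot).
have : 0 <= dot f f := dnorm_ge0 dot f.
rewrite lecE => /andP[/eqP/= i0 _].
have := sqr_hnorm f; rewrite f0 expr0n /= => r0.
by rewrite eq_complex /= i0 -r0 !eqxx.
Qed.

Lemma sqr_hnormD f g : nrm (f + g) ^+ 2 = nrm f ^+ 2 + 2 * rdot f g + nrm g ^+ 2.
Proof.
by rewrite !sqr_hnorm rdotDl !rdotDr (rdotC g f); ring.
Qed.

Lemma rdot_le f g : `|rdot f g| <= nrm f * nrm g.
Proof.
have [g0|g0] := eqVneq (nrm g) 0.
  by rewrite (hnorm_eq0 g0) linear0r /= normr0 hnorm0 mulr0.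
rewrite -(ler_pXn2r (n := 2))// ?nnegrE ?mulr_ge0 ?hnorm_ge0//.
have gp : 0 < nrm g ^+ 2 by rewrite exprn_gt0// lt_def g0 hnorm_ge0.
(* this vector is |g|^2 times the component of f orthogonal to g over R *)
have := sqr_ge0 (nrm ((nrm g ^+ 2)%:C%C *: f + (- rdot f g)%:C%C *: g)).
rewrite sqr_hnormD !sqr_hnorm !rdotZl !rdotZr.
rewrite real_normK ?num_real// exprMn -!sqr_hnorm.
move: (rdot f g) (nrm f ^+ 2) (nrm g ^+ 2) gp => r x y y0 h.
rewrite -subr_ge0 -(pmulr_rge0 _ y0); lra.
Qed.

Lemma ler_hnormD f g : nrm (f + g) <= nrm f + nrm g.
Proof.
rewrite -(ler_pXn2r (n := 2))// ?nnegrE ?addr_ge0 ?hnorm_ge0//.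
rewrite sqr_hnormD sqrrD; have := rdot_le f g.
by move=> /(le_trans (ler_norm _)); rewrite -mulr_natr; lra.
Qed.

Lemma hnorm_dist f g : nrm (f - g) = nrm (g - f).
Proof. by rewrite -hnorm_opp opprB. Qed.

Lemma le_cvg0 (u e : nat -> R) (a : R) : (forall n, `|u n - a| <= e n) ->
  e n @[n --> \oo] --> (0 : R) -> u n @[n --> \oo] --> a.
Proof.
move=> ue e0; apply/subr_cvg0/norm_cvg0P.
apply: (@squeeze_cvgr _ _ _ _ (fun=> 0) e) => //; last exact: cvg_cst.
by near=> n; rewrite normr_ge0 ue.
Unshelve. all: by end_near. Qed.

Lemma hcvg_le (u : nat -> H) f (e : nat -> R) :
  (forall n, nrm (u n - f) <= e n) -> e n @[n --> \oo] --> (0 : R) ->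
  hcvg dot u f.
Proof.
by move=> ue; apply: le_cvg0 => n; rewrite subr0 ger0_norm ?hnorm_ge0.
Qed.

Lemma hcvg_lt (u : nat -> H) f (e : R) : hcvg dot u f -> 0 < e ->
  exists N, forall n, (N <= n)%N -> nrm (u n - f) < e.
Proof.
move=> uf e0.
have /cvgrPdist_lt/(_ _ e0)[N _ NP] : nrm (u n - f) @[n --> \oo] --> (0 : R)
  := uf.
exists N => n /NP; rewrite sub0r normrN ger0_norm//; exact: hnorm_ge0.
Qed.

Lemma hcvgD (u v : nat -> H) f g :
  hcvg dot u f -> hcvg dot v g -> hcvg dot (fun n => u n + v n) (f + g).
Proof.
move=> uf vg.
apply: (@hcvg_le _ _ (fun n => nrm (u n - f) + nrm (v n - g))) => [n|].
  by rewrite opprD addrACA ler_hnormD.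
by rewrite -[0](addr0 0); apply: cvgD.
Qed.

Lemma hcvgZ z (u : nat -> H) f :
  hcvg dot u f -> hcvg dot (fun n => z *: u n) (z *: f).
Proof.
move=> uf; apply: (@hcvg_le _ _ (fun n => Normc.normc z * nrm (u n - f))) => [n|].
  by rewrite -scalerBr hnormZ.
by rewrite -[0](mulr0 (Normc.normc z)); apply: cvgM => //; exact: cvg_cst.
Qed.

Lemma hcvgN (u : nat -> H) f :
  hcvg dot u f -> hcvg dot (fun n => - u n) (- f).
Proof.
by move=> uf; apply: hcvg_le uf => n; rewrite -opprD hnorm_opp.
Qed.

Lemma hcvg_cst f : hcvg dot (fun=> f) f.
Proof.
apply: (@hcvg_le _ _ (fun=> 0)) => [n|]; last exact: cvg_cst.
by rewrite subrr hnorm0.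
Qed.

Lemma cvg_rdot (u v : nat -> H) f g : hcvg dot u f -> hcvg dot v g ->
  rdot (u n) (v n) @[n --> \oo] --> rdot f g.
Proof.
move=> uf vg.
pose e n := nrm (u n - f) * nrm (v n - g) + nrm (u n - f) * nrm g +
  nrm f * nrm (v n - g).
apply: (@le_cvg0 _ e) => [n|].
  have -> : rdot (u n) (v n) - rdot f g =
      rdot (u n - f) (v n - g) + rdot (u n - f) g + rdot f (v n - g).
    by rewrite !(rdotDl, rdotDr, rdotNl, rdotNr); ring.
  apply: le_trans (ler_normD _ _) _; apply: lerD; last exact: rdot_le.
  by apply: le_trans (ler_normD _ _) _; apply: lerD; exact: rdot_le.
have -> : 0 = 0 * 0 + 0 * nrm g + nrm f * 0 :> R by ring.
by apply: cvgD; [apply: cvgD|]; apply: cvgM => //; exact: cvg_cst.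
Qed.

Lemma cvg_hnorm (u : nat -> H) f :
  hcvg dot u f -> nrm (u n) @[n --> \oo] --> nrm f.
Proof.
move=> uf; apply: (@le_cvg0 _ (fun n => nrm (u n - f))) => // n.
have := ler_hnormD (u n - f) f; have := ler_hnormD (f - u n) (u n).
by rewrite !subrK hnorm_dist ler_norml => ? ?; apply/andP; split; lra.
Qed.

Lemma cvg_sqr_hnorm (u : nat -> H) f :
  hcvg dot u f -> nrm (u n) ^+ 2 @[n --> \oo] --> nrm f ^+ 2.
Proof.
move=> uf; rewrite expr2; under eq_fun do rewrite expr2.
by apply: cvgM; exact: cvg_hnorm.
Qed.

End inner_product.

(** * Accretive operators and their closures *)

Section operators.
Variables (R : realType) (H : lmodType R[i]) (dot : {dot H for Num.conj}).
Implicit Types (A : set (H * H)) (W : set H) (f g h : H) (z : R[i]).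

Local Notation nrm := (hnorm dot).
Local Notation rdot f g := (complex.Re (dot f g)).

Definition hcauchy (u : nat -> H) : Prop := forall e : R, 0 < e ->
  exists N, forall n k, (N <= n)%N -> (N <= k)%N -> nrm (u n - u k) <= e.

Definition hcomplete : Prop :=
  forall u, hcauchy u -> exists f, hcvg dot u f.

Definition linear_set W : Prop :=
  W 0 /\ forall z f g, W f -> W g -> W (z *: f + g).

(** The parallelogram law: h is almost as far from the midpoint of w n and w k as
    the minimal distance allows, which forces w n and w k together. *)
Lemma minimizing_sequence_cauchy W h (d : R) (w : nat -> H) : linear_set W ->
  (forall v, W v -> d <= nrm (h - v) ^+ 2) ->
  (forall n, W (w n) /\ nrm (h - w n) ^+ 2 < d + n.+1%:R^-1) -> hcauchy w.
Proof.
move=> [W0 WL] dW wP e e0.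
have half (f g : H) : W f -> W g -> W ((2^-1)%:C%C *: (f + g)).
  move=> Wf Wg; rewrite -[_ *: _]addr0; apply: (WL) => //.
  by rewrite -[f]scale1r; exact: WL.
have [N /= Ne] : exists N : nat, 4 / e ^+ 2 < N.+1%:R.
  exists (Num.bound (4 / e ^+ 2)); apply: lt_trans (_ : _ < (Num.bound _)%:R) _.
    by apply: archi_boundP; rewrite divr_ge0 ?sqr_ge0.
  by rewrite ltr_nat.
exists N => n k Nn Nk.
have inv (i : nat) : (N <= i)%N -> i.+1%:R^-1 <= e ^+ 2 / 4 :> R.
  move=> Ni; rewrite -[leRHS]invrK lef_pV2 ?posrE ?invr_gt0 ?divr_gt0 ?exprn_gt0//.
  by rewrite invf_div (le_trans (ltW Ne))// ler_nat ltnS.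
rewrite -(ler_pXn2r (n := 2)) ?nnegrE ?hnorm_ge0 ?(ltW e0)//.
have := dW _ (half _ _ (wP n).1 (wP k).1).
have -> : h - (2^-1)%:C%C *: (w n + w k) =
    (2^-1)%:C%C *: ((h - w n) + (h - w k)).
  have {1}-> : h = (2^-1)%:C%C *: (h + h).
    rewrite -[h in RHS]scale1r -scalerDl scalerA -[LHS]scale1r; congr (_ *: _).
    by apply/eqP; rewrite eq_complex /=; apply/andP; split; apply/eqP; field.
  by rewrite -scalerBr opprD addrACA.
have -> : w n - w k = (h - w k) - (h - w n) by rewrite opprB [RHS]addrC subrKA.
move: (wP n) (wP k) (inv _ Nn) (inv _ Nk) => [_ nP] [_ kP].
rewrite [X in d <= X]sqr_hnorm rdotZl rdotZr -sqr_hnorm.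
rewrite (sqr_hnormD _ (h - w n)) (sqr_hnormD _ (h - w k)) hnorm_opp rdotNr.
rewrite (rdotC _ (h - w k)); move: nP kP.
move: (_ ^+ 2) (_ ^+ 2) (rdot _ _) n.+1%:R^-1 k.+1%:R^-1 (e ^+ 2).
by move=> *; lra.
Qed.

(** The quadratic polynomial t |-> |h - k + t v|^2 is minimal at t = 0.  The
    limit k need not lie in W, so minimality is inherited from h - w n. *)
Lemma minimizer_orthogonal W h (d : R) k : linear_set W ->
  (forall v, W v -> d <= nrm (h - v) ^+ 2) ->
  forall w : nat -> H,
  (forall n, W (w n) /\ nrm (h - w n) ^+ 2 < d + n.+1%:R^-1) ->
  hcvg dot w k -> forall v, W v -> rdot v (h - k) = 0.
Proof.
move=> [W0 WL] dW w wP wk v Wv.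
have hw : hcvg dot (fun n => h - w n) (h - k).
  by apply: hcvgD; [exact: hcvg_cst|exact: hcvgN].
have dk : nrm (h - k) ^+ 2 <= d.
  have dn : d + n.+1%:R^-1 @[n --> \oo] --> d.
    rewrite -[X in _ --> X]addr0.
    by apply: cvgD; [exact: cvg_cst|exact: cvg_harmonic].
  apply: ler_cvg_to (cvg_sqr_hnorm hw) dn _; near=> n.
  by exact/ltW/(wP n).2.
have ge (t : R) : d <= nrm (h - k + t%:C%C *: v) ^+ 2.
  apply: cvgr_to_ge (cvg_sqr_hnorm (hcvgD hw (hcvg_cst _ _))) _.
  near=> n.
  rewrite -[h - _ + _]addrA -[- w n + _]opprK; apply: dW.
  rewrite opprD opprK addrC -scaleNr; apply: WL => //; exact: (wP n).1.
move: (rdot_ge0 dot v) => y0.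
(* a negative multiple of the linear coefficient, with + 1 in the denominator
   to cover v = 0 *)
have := ge (- rdot v (h - k) / (rdot v v + 1)).
rewrite sqr_hnormD [X in _ <= _ + X]sqr_hnorm rdotZl !rdotZr (rdotC _ _ v).
move: (rdot v _) (rdot v v) y0 => r y y0 h1.
have y1 : 0 < y + 1 by lra.
have h2 : 0 <= - (r ^+ 2 * (y + 2)) / (y + 1) ^+ 2.
  rewrite (_ : _ / _ = 2 * (- r / (y + 1) * r) +
    - r / (y + 1) * (- r / (y + 1) * y)); first by lra.
  by field; rewrite gt_eqF.
move: h2; rewrite pmulr_lge0 ?invr_gt0 ?exprn_gt0// oppr_ge0 pmulr_lle0; last lra.
by move=> r2; apply/eqP; rewrite -sqrf_eq0 eq_le r2 sqr_ge0.
Unshelve. all: by end_near. Qed.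

(** A sequence in W minimizing the distance to h converges by completeness, and
    its limit differs from h by a vector orthogonal to W. *)
Lemma dense_of_trivial_orthogonal W h : hcomplete -> linear_set W ->
  (forall k, (forall v, W v -> rdot v k = 0) -> k = 0) ->
  exists2 w : nat -> H, forall n, W (w n) & hcvg dot w h.
Proof.
move=> hc WL W0.
pose S := [set nrm (h - v) ^+ 2 | v in W].
have Slb : lbound S 0 by move=> _ [v _ <-]; exact: sqr_ge0.
have Sinf : has_inf S.
  by split; [exists (nrm (h - 0) ^+ 2), 0 => //; exact: WL.1|exists 0].
have dW v : W v -> inf S <= nrm (h - v) ^+ 2.
  by move=> Wv; apply: ge_inf; [exists 0|exists v].
have /choice[w wP] (n : nat) :
    exists v, W v /\ nrm (h - v) ^+ 2 < inf S + n.+1%:R^-1.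
  have [|_ [v Wv <-] lt] := @inf_adherent _ S n.+1%:R^-1 _ Sinf.
    by rewrite invr_gt0.
  by exists v.
exists w => [n|]; first exact: (wP n).1.
have [k wk] := hc _ (minimizing_sequence_cauchy WL dW wP).
have /eqP := W0 _ (minimizer_orthogonal WL dW wP wk).
by rewrite subr_eq0 => /eqP ->.
Qed.

Lemma op_closure_operator A : is_operator A ->
  (forall f g h, op_closure dot A (f, g) -> op_closure dot A (f, h) -> g = h) ->
  is_operator (op_closure dot A).
Proof.
move=> [A0 AL _] A1; split=> //.
  by exists (fun=> (0, 0)); split=> //; exact: hcvg_cst.
move=> z p q [u [Au u1 u2]] [v [Av v1 v2]].
exists (fun n => (z *: (u n).1 + (v n).1, z *: (u n).2 + (v n).2)); split.
- by move=> n; exact: AL.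
- by apply: hcvgD => //; exact: hcvgZ.
- by apply: hcvgD => //; exact: hcvgZ.
Qed.

(** The lower bound on A + z turns convergence of A f_n + z f_n into convergence
    of f_n, so that a dense range of A + z becomes a full range after closing A. *)
Lemma op_closure_range A z (c : R) : hcomplete -> is_operator A -> 0 < c ->
  (forall f g, A (f, g) -> c * nrm f <= nrm (g + z *: f)) ->
  (forall k, (forall f g, A (f, g) -> rdot (g + z *: f) k = 0) -> k = 0) ->
  forall h, exists f, op_closure dot A (f, h - z *: f).
Proof.
move=> hc [A0 AL _] c0 Ac Aperp h.
pose W := [set v | exists2 p, A p & v = p.2 + z *: p.1].
have WL : linear_set W.
  split; first by exists (0, 0) => //=; rewrite scaler0 addr0.
  move=> t _ _ [p Ap ->] [q Aq ->]; exists (t *: p.1 + q.1, t *: p.2 + q.2).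
    exact: AL.
  by rewrite /= !scalerDr !scalerA (mulrC z) addrACA.
have [|w Ww wh] := @dense_of_trivial_orthogonal W h hc WL.
  by move=> k Wk; apply: Aperp => f g Afg; apply: Wk; exists (f, g).
have /choice[u uP] (n : nat) :
    exists p : H * H, A p /\ w n = p.2 + z *: p.1.
  by have [p Ap ->] := Ww n; exists p.
have uC : hcauchy (fst \o u).
  move=> e e0; have ce0 : 0 < c * e / 2 by rewrite divr_gt0// mulr_gt0.
  have [N NP] := hcvg_lt wh ce0; exists N => n k Nn Nk.
  rewrite -(ler_pM2l c0).
  have Ank : A ((u n).1 - (u k).1, (u n).2 - (u k).2).
    have := AL (-1) _ _ (uP k).1 (uP n).1.
    by rewrite !scaleN1r ![- _ + _]addrC.
  apply: le_trans (Ac _ _ Ank) _.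
  have -> : (u n).2 - (u k).2 + z *: ((u n).1 - (u k).1) = (w n - h) + (h - w k).
    by rewrite subrKA (uP n).2 (uP k).2 scalerBr opprD addrACA.
  apply: le_trans (ler_hnormD _ _ _) _; rewrite (hnorm_dist _ h).
  have := NP _ Nn; have := NP _ Nk => /=.
  by lra.
have [f uf] := hc _ uC; exists f, u; split=> // [n|]; first exact: (uP n).1.
have -> : snd \o u = fun n => w n + (- z) *: (fst \o u) n.
  by apply/funext => n /=; rewrite (uP n).2 scaleNr addrK.
by rewrite /= -scaleNr; apply: hcvgD => //; exact: hcvgZ.
Qed.

Lemma accretive_bounded_below A z f g : accretive dot A -> A (f, g) ->
  complex.Re z * nrm f <= nrm (g + z *: f).
Proof.
move=> Aacc Afg; have [f0|f0] := eqVneq (nrm f) 0.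
  by rewrite f0 mulr0 hnorm_ge0.
have fp : 0 < nrm f by rewrite lt_def f0 hnorm_ge0.
rewrite -(ler_pM2r fp) -mulrA -expr2 sqr_hnorm -rdotZxx.
apply: le_trans (rdot_le _ _ _); apply: le_trans (ler_norm _).
by rewrite rdotDl lerDr; exact: Aacc.
Qed.

(** Accretivity bounds A + z below by Re z, which gives both injectivity and the
    resolvent estimate; only surjectivity remains to be assumed. *)
Lemma m_accretive_of_range A : is_operator A -> accretive dot A ->
  (forall z, 0 < complex.Re z -> forall h, exists f, A (f, h - z *: f)) ->
  m_accretive dot A.
Proof.
move=> [A0 AL A1] Aacc Aran.
have bnd z : 0 < complex.Re z ->
    (op_norm dot (op_inv (op_sub A (- z)%R)) <= ((complex.Re z)^-1)%R%:E)%E.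
  move=> z0; apply: ge_ereal_sup => _ [[h f] [/= Ah h1] <-].
  rewrite lee_fin -(ler_pM2l z0) mulfV ?gt_eqF//; apply: le_trans h1.
  have := accretive_bounded_below z Aacc Ah.
  by rewrite scaleNr subrK.
split=> // z /= z0.
have w0 : 0 < complex.Re (- z) by rewrite ReCN oppr_gt0.
have := bnd _ w0; have := Aran _ w0.
have inj f h : A (f, h + z *: f) -> nrm f <= (complex.Re (- z))^-1 * nrm h.
  move=> /(accretive_bounded_below (- z) Aacc).
  by rewrite scaleNr addrK -ler_pdivlMl.
rewrite opprK => ran nb; split.
- split; rewrite /op_inv /op_sub /=.
  + by rewrite scaler0 addr0.
  + move=> t p q Ap Aq.
    rewrite scalerDr addrACA scalerA (mulrC z) -scalerA -scalerDr.
    exact: (AL t (_, _) (_, _)).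
  + move=> h f g Af Ag; apply/eqP; rewrite -subr_eq0; apply/eqP.
    apply: (@hnorm_eq0 _ _ dot); apply/eqP; rewrite eq_le hnorm_ge0 andbT.
    rewrite -[leRHS](mulr0 (complex.Re (- z))^-1) -(hnorm0 dot); apply: inj.
    have := AL (-1) _ _ Ag Af; rewrite /= !scaleN1r opprD addrACA addNr.
    by rewrite -scalerN -scalerDr (addrC f).
- apply/seteqP; split=> // h _; have [f] := ran h.
  by rewrite scaleNr opprK; exists f.
- by apply: le_lt_trans nb _; rewrite ltry.
Qed.

(** The form inequality has slope 1, whence the semi-angle pi / 4; the vertex - c
    makes A + c accretive and leaves density of the range of A + z to be checked
    for Re z > c only. *)
Theorem m_sectorial_closure A (c : R) : hcomplete -> is_operator A ->
  is_operator (op_closure dot A) ->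
  (forall f g, A (f, g) ->
    `|complex.Im (dot g f)| <= complex.Re (dot g f) + c * nrm f ^+ 2) ->
  (forall z k, c < complex.Re z ->
    (forall f g, A (f, g) -> rdot (g + z *: f) k = 0) -> k = 0) ->
  m_sectorial dot (op_closure dot A).
Proof.
move=> hc Aop Acl Asec Aperp; split=> //.
have sec f g : op_closure dot A (f, g) ->
    `|complex.Im (dot g f)| <= complex.Re (dot g f) + c * nrm f ^+ 2.
  move=> [u [Au uf ug]].
  have lhs : `|complex.Im (dot (u n).2 (u n).1)| @[n --> \oo] -->
      `|complex.Im (dot g f)|.
    apply: cvg_norm; rewrite idot_rdot; under eq_fun do rewrite idot_rdot.
    by apply: cvgN; apply: cvg_rdot => //; exact: hcvgZ.
  have rhs : rdot (u n).2 (u n).1 + c * nrm (u n).1 ^+ 2 @[n --> \oo] -->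
      rdot g f + c * nrm f ^+ 2.
    apply: cvgD; first exact: cvg_rdot.
    apply: cvgM; first exact: cvg_cst.
    rewrite expr2; under eq_fun do rewrite expr2.
    by apply: cvgM; exact: cvg_hnorm.
  apply: ler_cvg_to lhs rhs _; apply: nearW => n; apply: Asec.
  by case: (u n) (Au n).
exists (- c), (pi / 4); split.
  have pi0 := pi_gt0 R; split; [lra|lra|].
  move=> _ [[f g] [/= /sec h f1] <-]; move: h.
  rewrite f1 expr1n mulr1 /sector /= tan_piquarter mul1r opprK => h; split=> //.
  by have := normr_ge0 (complex.Im (dot g f)); lra.
have clop : is_operator (op_sub (op_closure dot A) (- c)%:C%C).
  have [C0 CL C1] := Acl; split; rewrite /op_sub /=.
  + by rewrite scaler0 addr0.
  + move=> t p q Ap Aq; rewrite scalerDr addrACA scalerA mulrC -scalerA -scalerDr.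
    exact: (CL t (_, _) (_, _)).
  + by move=> f g h Cg Ch; apply: (addIr ((- c)%:C%C *: f)); exact: C1 Cg Ch.
have acc : accretive dot (op_sub (op_closure dot A) (- c)%:C%C).
  move=> f g /sec; rewrite linearDl ReCD rdotZl -sqr_hnorm.
  by move=> /(le_trans (normr_ge0 _)); lra.
apply: m_accretive_of_range => // z z0 h.
have z1 : c < complex.Re (z + c%:C%C) by rewrite ReCD /= ltrDr.
have [f g Afg||f Af] := @op_closure_range A (z + c%:C%C) _ hc Aop z0 _ _ h.
- have Cfg : op_sub (op_closure dot A) (- c)%:C%C (f, g + c%:C%C *: f).
    rewrite /op_sub /= -addrA -scalerDl -rmorphD /= subrr scale0r addr0.
    by exists (fun=> (f, g)); split=> //; exact: hcvg_cst.
  have := accretive_bounded_below z acc Cfg.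
  by rewrite -addrA -scalerDl (addrC z).
- by move=> k; exact: Aperp.
exists f; rewrite /op_sub /=; move: Af.
by rewrite scalerDl opprD addrA rmorphN /= scaleNr.
Qed.

End operators.

(** * Sums over a choice type that reduce to finite sums *)

Section finite_sums.
Variables (R : realType) (T : choiceType).
Implicit Types (s r : seq T) (u : T -> R).

Lemma fsbigT_seq (K : nmodType) (F : T -> K) s : uniq s ->
  (forall x, x \notin s -> F x = 0) ->
  \sum_(x \in [set: T]) F x = \sum_(x <- s) F x.
Proof.
move=> us F0; rewrite [RHS]fsbig_seq//; symmetry.
apply: fsbig_widen => // x [_ /=].
by move=> /negP; exact: F0.
Qed.

Lemma ler_sum_subset u s r : uniq s -> uniq r -> {subset s <= r} ->
  (forall x, 0 <= u x) -> \sum_(x <- s) u x <= \sum_(x <- r) u x.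
Proof.
move=> us ur sr u0.
have sP : perm_eq s [seq x <- r | x \in s].
  apply: uniq_perm => //; first exact: filter_uniq.
  by move=> x; rewrite mem_filter; case xs: (x \in s) => //=; rewrite sr.
rewrite (perm_big _ sP) big_filter big_mkcond /=; apply: ler_sum => x _.
by case: ifP.
Qed.

Lemma esumT_seq u s : uniq s -> (forall x, 0 <= u x) ->
  (forall x, x \notin s -> u x = 0) ->
  (\esum_(x in [set: T]) (u x)%:E)%E = (\sum_(x <- s) u x)%:E.
Proof.
move=> us u0 us0; rewrite (esumID [set` s]); last by move=> x _; rewrite lee_fin.
rewrite [X in (_ + X)%E]esum1 ?adde0; last first.
  by move=> x [_ /= /negP xs]; rewrite us0.
rewrite setTI esum_fset//; last by move=> x _; rewrite lee_fin.
by rewrite fsumEFin// -fsbig_seq.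
Qed.

Lemma rsum_seq u s : uniq s -> (forall x, x \notin s -> u x = 0) ->
  rsum u = \sum_(x <- s) u x.
Proof.
move=> us us0.
have sfin (v : T -> R) : (forall x, x \notin s -> v x = 0) -> rsummable v.
  move=> v0; rewrite /rsummable /summable /= (@esumT_seq (fun x => `|v x|) s)//.
    exact: ltry.
  by move=> x /v0 ->; rewrite normr0.
have pos (v : T -> R) : (forall x, 0 <= v x) -> (forall x, x \notin s -> v x = 0) ->
    rsum v = \sum_(x <- s) v x.
  by move=> v0 vs; rewrite rsum_ge0E// ?(esumT_seq us)//; exact: sfin.
pose p x := Num.max (u x) 0; pose n x := Num.max (- u x) 0.
have p0 x : 0 <= p x by rewrite /p le_max lexx orbT.
have n0 x : 0 <= n x by rewrite /n le_max lexx orbT.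
have ps x : x \notin s -> p x = 0 by move=> /us0; rewrite /p => ->; rewrite maxxx.
have ns x : x \notin s -> n x = 0.
  by move=> /us0; rewrite /n => ->; rewrite oppr0 maxxx.
have uE : u = fun x => p x + (-1) * n x.
  by apply/funext => x; rewrite /p /n /Num.max; do 2 case: ifPn; lra.
rewrite {1}uE rsumD; [|exact: sfin|by apply: rsummableZ; exact: sfin].
rewrite rsumZ; last exact: sfin.
rewrite !pos// mulr_sumr -big_split; apply: eq_bigr => x _.
by rewrite [in RHS]uE.
Qed.

Lemma cvg_sum_seq (F : T -> nat -> R) (l : T -> R) s :
  (forall x, F x n @[n --> \oo] --> l x) ->
  \sum_(x <- s) F x n @[n --> \oo] --> \sum_(x <- s) l x.
Proof.
move=> Fl; elim: s => [|x s IH].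
  by under eq_fun do rewrite big_nil; rewrite big_nil; exact: cvg_cst.
by under eq_fun do rewrite big_cons; rewrite big_cons; exact: cvgD.
Qed.

End finite_sums.

Lemma finite_sub_exhaustion (T : eqType) (B : nat -> set T) (r : seq T) :
  (forall n, B n `<=` B n.+1) -> \bigcup_n B n = [set: T] ->
  exists n, forall x, x \in r -> B n x.
Proof.
move=> Bincr Bcover.
have Bmon i j : (i <= j)%N -> B i `<=` B j.
  apply: (@homo_leq _ B (fun X Y => X `<=` Y)) => [X|Y X Z|]; last exact: Bincr.
    exact: subset_refl.
  exact: subset_trans.
elim: r => [|x r [n rB]]; first by exists 0.
have [i _ Bx] : (\bigcup_n B n) x by rewrite Bcover.
exists (maxn i n) => y; rewrite inE => /orP[/eqP ->|yr].
  exact: Bmon (leq_maxl _ _) _ Bx.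
exact: Bmon (leq_maxr _ _) _ (rB _ yr).
Qed.

(** * Completeness of the weighted l2 space *)

Lemma real_cauchy_cvg (R : realType) (a : nat -> R) :
  (forall e, 0 < e -> exists N, forall n, (N <= n)%N -> `|a N - a n| < e) ->
  exists l : R, a n @[n --> \oo] --> l.
Proof.
move=> aC; suff : cvg (a n @[n --> \oo]).
  by move=> ac; exists (lim (a n @[n --> \oo])).
by apply/cauchy_cvgP/cauchy_exP => e /aC[N NP]; exists (a N), N.
Qed.

Section l2_space.
Variables (R : realType) (V : countType) (G : wdigraph R V).
Local Notation m := (vertex_weight G).
Local Notation nrm := (hnorm (l2_dot G)).
Implicit Types (f g : l2 G) (s : seq V).

Definition sqr_mod (z : R[i]) : R := complex.Re z ^+ 2 + complex.Im z ^+ 2.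

Lemma sqr_mod_ge0 z : 0 <= sqr_mod z.
Proof. by rewrite addr_ge0 ?sqr_ge0. Qed.

Lemma mass_ge0 (u : V -> R[i]) x : 0 <= m x * sqr_mod (u x).
Proof. by rewrite mulr_ge0 ?sqr_mod_ge0// ltW// vertex_weight_gt0. Qed.

Lemma sqr_hnorm_l2 f :
  ((nrm f ^+ 2)%:E = \esum_(x in [set: V]) (m x * sqr_mod (f x))%:E)%E.
Proof.
rewrite sqr_hnorm -[complex.Re _]/(complex.Re (l2_dot G f f)).
rewrite l2_dotxx /= /sqr_mod.
under eq_esum do rewrite normc_sqr.
rewrite fineK//; apply: ge0_fin_num; first exact: mass_ge0.
by apply/square_summableP; exact: (valP f).
Qed.

Lemma l2_sum_le f s : uniq s ->
  \sum_(x <- s) m x * sqr_mod (f x) <= nrm f ^+ 2.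
Proof.
move=> us; rewrite -lee_fin sqr_hnorm_l2; apply: esum_ge.
exists [set` s]; first by split=> //; exact: finite_seq.
by rewrite -fsbig_seq// sumEFin.
Qed.

Lemma esum_mass_le (u : V -> R[i]) (M : R) :
  (forall s, uniq s -> \sum_(x <- s) m x * sqr_mod (u x) <= M) ->
  (\esum_(x in [set: V]) (m x * sqr_mod (u x))%:E <= M%:E)%E.
Proof.
move=> uM; apply: ge_ereal_sup => _ [A [fA _] <-].
by rewrite fsbig_finite//= sumEFin lee_fin; apply: uM; exact: finmap.fset_uniq.
Qed.

Lemma sqr_hnorm_le f (M : R) :
  (forall s, uniq s -> \sum_(x <- s) m x * sqr_mod (f x) <= M) ->
  nrm f ^+ 2 <= M.
Proof. by move=> /esum_mass_le; rewrite -sqr_hnorm_l2 lee_fin. Qed.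

Lemma square_summable_bounded (u : V -> R[i]) (M : R) :
  (forall s, uniq s -> \sum_(x <- s) m x * sqr_mod (u x) <= M) ->
  u \in square_summable G.
Proof.
move=> /esum_mass_le uM; apply/asboolP => /=.
by under eq_esum do rewrite normc_sqr; apply: le_lt_trans uM (ltry _).
Qed.

Lemma l2_dot_seq f g s : uniq s -> (forall x, x \notin s -> f x = 0) ->
  l2_dot G f g =
    ((\sum_(x <- s) m x * (complex.Re (f x) * complex.Re (g x) +
                           complex.Im (f x) * complex.Im (g x))) +i*
     (\sum_(x <- s) m x * (complex.Im (f x) * complex.Re (g x) -
                           complex.Re (f x) * complex.Im (g x))))%C.
Proof.
move=> us fs.
apply/eqP; rewrite eq_complex /=; apply/andP; split; apply/eqP.
- rewrite (rsum_seq us) => [|x /fs ->]; last by rewrite mulr0 mul0r.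
  apply: eq_bigr => x _; rewrite ReCM ReCJ ImCJ.
  by rewrite ReCM ImCM /=; ring.
- rewrite (rsum_seq us) => [|x /fs ->]; last by rewrite mulr0 mul0r.
  apply: eq_bigr => x _; rewrite ImCM ReCJ ImCJ.
  by rewrite ReCM ImCM /=; ring.
Qed.

Lemma point_le f x : m x * sqr_mod (f x) <= nrm f ^+ 2.
Proof. by have := @l2_sum_le f [:: x] isT; rewrite big_seq1. Qed.

Lemma coord_le f x (c : R) :
  c ^+ 2 <= sqr_mod (f x) -> `|c| <= nrm f / Num.sqrt (m x).
Proof.
move=> cf; have m0 := vertex_weight_gt0 G x.
rewrite ler_pdivlMr ?sqrtr_gt0// -(ler_pXn2r (n := 2))//; last 2 first.
- by rewrite nnegrE mulr_ge0 ?sqrtr_ge0.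
- by rewrite nnegrE hnorm_ge0.
rewrite exprMn sqr_sqrtr ?(ltW m0)// real_normK ?num_real// mulrC.
by apply: le_trans (point_le f x); rewrite ler_pM2l.
Qed.

Lemma Re_point_le f x : `|complex.Re (f x)| <= nrm f / Num.sqrt (m x).
Proof. by apply: coord_le; rewrite lerDl sqr_ge0. Qed.

Lemma Im_point_le f x : `|complex.Im (f x)| <= nrm f / Num.sqrt (m x).
Proof. by apply: coord_le; rewrite lerDr sqr_ge0. Qed.

Lemma l2_subE f g x : (f - g) x = f x - g x.
Proof. by []. Qed.

Lemma hcvg_pointwise (u : nat -> l2 G) f x : hcvg (l2_dot G) u f ->
  complex.Re (u n x) @[n --> \oo] --> complex.Re (f x) /\
  complex.Im (u n x) @[n --> \oo] --> complex.Im (f x).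
Proof.
move=> uf.
have lim0 : nrm (u n - f) / Num.sqrt (m x) @[n --> \oo] --> (0 : R).
  rewrite -[0](mul0r (Num.sqrt (m x))^-1); apply: cvgM => //; exact: cvg_cst.
by split; apply: le_cvg0 lim0 => n;
  rewrite -?ReCN -?ImCN -?ReCD -?ImCD -l2_subE ?Re_point_le ?Im_point_le.
Qed.

(** The limit is taken vertex by vertex; letting k go to infinity in the finite
    partial sums of |u n - u k|^2 bounds the l2 distance from u n to it. *)
Theorem l2_complete : hcomplete (l2_dot G).
Proof.
move=> u uC.
have coordC (F : R[i] -> R) x : {morph F : z w / z - w} ->
    (forall f, `|F (f x)| <= nrm f / Num.sqrt (m x)) ->
    exists l : R, F (u n x) @[n --> \oo] --> l.
  move=> FB Fle; apply: real_cauchy_cvg => e e0.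
  have sm : 0 < Num.sqrt (m x) by rewrite sqrtr_gt0 vertex_weight_gt0.
  have e2 : 0 < e / 2 * Num.sqrt (m x) by rewrite mulr_gt0 ?divr_gt0.
  have [N NP] := uC _ e2.
  exists N => n Nn; rewrite -FB -l2_subE; apply: le_lt_trans (Fle _) _.
  rewrite ltr_pdivrMr//; apply: le_lt_trans (NP _ _ _ Nn) _ => //.
  by rewrite ltr_pM2r//; lra.
have /choice[a aP] x := coordC (@complex.Re R) x (fun z w => etrans (ReCD _ _)
  (congr1 _ (ReCN _))) (fun f => Re_point_le f x).
have /choice[b bP] x := coordC (@complex.Im R) x (fun z w => etrans (ImCD _ _)
  (congr1 _ (ImCN _))) (fun f => Im_point_le f x).
pose l x : R[i] := (a x +i* b x)%C.
have tail (e : R) : 0 < e -> exists N, forall n, (N <= n)%N ->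
    forall s, uniq s -> \sum_(x <- s) m x * sqr_mod (u n x - l x) <= e ^+ 2.
  move=> e0; have [N NP] := uC e e0; exists N => n Nn s us.
  have lim : \sum_(x <- s) m x * sqr_mod (u n x - u k x) @[k --> \oo] -->
      \sum_(x <- s) m x * sqr_mod (u n x - l x).
    apply: cvg_sum_seq => x; apply: cvgM; first exact: cvg_cst.
    rewrite /sqr_mod; under eq_fun do rewrite !ReCD !ImCD !ReCN !ImCN.
    rewrite ReCD ImCD ReCN ImCN /=.
    by apply: cvgD; under eq_fun do rewrite expr2; rewrite expr2; apply: cvgM;
      (apply: cvgB; [exact: cvg_cst|done]).
  apply: cvgr_to_le lim _; exists N => // k /= Nk.
  apply: le_trans (@l2_sum_le (u n - u k) s us) _.
  by rewrite ler_pXn2r ?nnegrE ?hnorm_ge0 ?(ltW e0)// NP.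
have [N NP] := tail 1 ltr01.
have dl : (fun x => u N x - l x) \in square_summable G.
  exact: square_summable_bounded (NP N (leqnn _)).
have lS : l \in square_summable G.
  have -> : l = l2_fun (u N - L2 dl) by apply/funext => x; rewrite l2_subE /= subKr.
  exact: (valP (u N - L2 dl)).
exists (L2 lS); apply/cvgr0Pnorm_le => e e0.
have [M MP] := tail e e0; exists M => // n /= Mn.
rewrite ger0_norm ?hnorm_ge0//.
have := sqr_hnorm_le (MP n Mn : forall s, uniq s -> \sum_(x <- s)
  m x * sqr_mod ((u n - L2 lS) x) <= e ^+ 2).
by rewrite ler_pXn2r ?nnegrE ?hnorm_ge0 ?(ltW e0).
Qed.

End l2_space.

(** * The two form estimates as finite double sums *)

Section double_sums.
Variables (R : realType) (T : Type) (s : seq T).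
Implicit Types (F : T -> T -> R).

Local Notation "\dsum F" := (\sum_(x <- s) \sum_(y <- s) F x y)
  (at level 35, F at level 9).

Lemma dsum_flip F : \dsum F = \dsum (fun x y => F y x).
Proof. exact: exchange_big. Qed.

Lemma dsumD F F' : \dsum (fun x y => F x y + F' x y) = \dsum F + \dsum F'.
Proof. by rewrite -big_split; apply: eq_bigr => x _; rewrite big_split. Qed.

Lemma dsumZ (c : R) F : \dsum (fun x y => c * F x y) = c * \dsum F.
Proof. by rewrite mulr_sumr; apply: eq_bigr => x _; rewrite mulr_sumr. Qed.

Lemma eq_dsum F F' : (forall x y, F x y = F' x y) -> \dsum F = \dsum F'.
Proof. by move=> FF'; do 2 apply: eq_bigr => ? _. Qed.

Lemma ler_dsum F F' : (forall x y, F x y <= F' x y) -> \dsum F <= \dsum F'.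
Proof. by move=> FF'; do 2 apply: ler_sum => ? _. Qed.

Lemma dsum_ge0 F : (forall x y, 0 <= F x y) -> 0 <= \dsum F.
Proof. by move=> F0; apply: sumr_ge0 => x _; apply: sumr_ge0. Qed.

Lemma ler_norm_dsum F : `|\dsum F| <= \dsum (fun x y => `|F x y|).
Proof.
apply: le_trans (ler_norm_sum _ _ _) _; apply: ler_sum => x _.
exact: ler_norm_sum.
Qed.

Lemma dsum_symmetrize F : \dsum F = 2^-1 * \dsum (fun x y => F x y + F y x).
Proof. by rewrite dsumD -dsum_flip; field. Qed.

Lemma ler_dsum_row F (w N : T -> R) (C : R) : (forall x, 0 <= N x) ->
  (forall x, \sum_(y <- s) F x y <= C * w x) ->
  \dsum (fun x y => F x y * N x) <= C * \sum_(x <- s) w x * N x.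
Proof.
move=> N0 FC; rewrite mulr_sumr; apply: ler_sum => x _.
by rewrite -mulr_suml mulrA ler_wpM2r.
Qed.

(** With E = d^2 / B this is the weighted inequality of arithmetic and geometric
    means; the product form E * B = d^2 also covers B = 0. *)
Lemma asym_am_gm (B E d D N J : R) : 0 <= B -> 0 <= E -> 0 <= D -> 0 <= N ->
  E * B = d ^+ 2 -> J ^+ 2 <= D * N -> `|d * J| <= (B * D + E * N) / 2.
Proof.
move=> B0 E0 D0 N0 EB JDN.
have h0 : 0 <= (B * D + E * N) / 2 by rewrite divr_ge0 ?addr_ge0 ?mulr_ge0.
rewrite -(ler_pXn2r (n := 2)) ?nnegrE// real_normK ?num_real//.
rewrite exprMn -EB; apply: le_trans (_ : E * B * (D * N) <= _).
  by rewrite ler_wpM2l// mulr_ge0.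
rewrite -subr_ge0 (_ : _ - _ = ((B * D - E * N) / 2) ^+ 2) ?sqr_ge0//.
by field.
Qed.

Variables (b e : T -> T -> R) (w : T -> R) (C2 : R).
Let b' x y := (b x y + b y x) / 2.
Hypothesis b0 : forall x y, 0 <= b x y.
Hypothesis e0 : forall x y, 0 <= e x y.
Hypothesis eb : forall x y, e x y * b' x y = (b x y - b y x) ^+ 2.
Hypothesis eC : forall x, \sum_(y <- s) e x y <= C2 * w x.

Let b'0 x y : 0 <= b' x y.
Proof. by rewrite divr_ge0// addr_ge0. Qed.

(** E and I are the real and imaginary parts of <Delta f, f> for f = p + i q; the
    hypothesis on N = |f|^2 is Kirchhoff's law tested against N. *)
Lemma sector_dsum (p q : T -> R) (N := fun x => p x ^+ 2 + q x ^+ 2)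
    (E := \dsum (fun x y =>
       b x y * ((p x - p y) * p x + (q x - q y) * q x)))
    (I := \dsum (fun x y =>
       b x y * ((q x - q y) * p x - (p x - p y) * q x))) :
  \dsum (fun x y => b x y * (N x - N y)) = 0 ->
  `|I| <= E + C2 * \sum_(x <- s) w x * N x.
Proof.
move=> K.
(* D is |f(x) - f(y)|^2, and J the imaginary part of f(x) times the conjugate of
   f(y); J is antisymmetric, so only b x y - b y x contributes to I *)
pose D x y := (p x - p y) ^+ 2 + (q x - q y) ^+ 2.
pose J x y := p y * q x - q y * p x.
have N0 x : 0 <= N x by rewrite addr_ge0 ?sqr_ge0.
have D0 x y : 0 <= D x y by rewrite addr_ge0 ?sqr_ge0.
have EE : E = 2^-1 * \dsum (fun x y => b' x y * D x y).
  transitivity (E + - 2^-1 * \dsum (fun x y => b x y * (N x - N y))).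
    by rewrite K mulr0 addr0.
  rewrite -dsumZ -dsumD.
  rewrite dsum_symmetrize; congr (_ * _); apply: eq_dsum => x y.
  by rewrite /b' /D /N; field.
have E0 : 0 <= E.
  by rewrite EE mulr_ge0 ?invr_ge0//; apply: dsum_ge0 => x y; rewrite mulr_ge0.
have IE : I = 2^-1 * \dsum (fun x y => (b x y - b y x) * J x y).
  rewrite /I dsum_symmetrize; congr (_ * _); apply: eq_dsum => x y.
  by rewrite /J; ring.
have Ile : `|I| <= 2^-1 * (E + 2^-1 * \dsum (fun x y => e x y * N x)).
  rewrite IE normrM gtr0_norm ?invr_gt0// ler_pM2l ?invr_gt0//.
  rewrite EE -mulrDr -dsumD -dsumZ.
  apply: le_trans (ler_norm_dsum _) _; apply: ler_dsum => x y.
  rewrite [leRHS]mulrC; apply: asym_am_gm => //.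
  rewrite -subr_ge0 /D /N /J.
  rewrite (_ : _ - _ = ((p x - p y) * p x + (q x - q y) * q x) ^+ 2) ?sqr_ge0//.
  by ring.
have := ler_dsum_row N0 eC.
have : 0 <= \dsum (fun x y => e x y * N x).
  by apply: dsum_ge0 => x y; rewrite mulr_ge0.
by move: Ile; lra.
Qed.

(** For k = P + i Q the right-hand side is Re <Delta (t^2 k), k>.  Up to the
    energy of t k, which is nonnegative, it consists of a symmetric commutator,
    quadratic in t x - t y, and an antisymmetric one, linear in t x - t y but
    carrying the factor b x y - b y x. *)
Lemma cutoff_dsum (t P Q : T -> R) (C1 : R)
    (N := fun x => P x ^+ 2 + Q x ^+ 2) :
  (forall x, 0 <= t x <= 1) ->
  (forall x, \sum_(y <- s) b' x y * (t x - t y) ^+ 2 <= C1 * w x) ->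
  \dsum (fun x y => b x y * (t x ^+ 2 * N x - t y ^+ 2 * N y)) = 0 ->
  - ((C1 + C2) * \sum_(x <- s) w x * N x) <=
  \dsum (fun x y => b x y * ((t x ^+ 2 * P x - t y ^+ 2 * P y) * P x +
                             (t x ^+ 2 * Q x - t y ^+ 2 * Q y) * Q x)).
Proof.
move=> t01 tC K; set E := (X in _ <= X).
have N0 x : 0 <= N x by rewrite addr_ge0 ?sqr_ge0.
have t0 x : 0 <= t x by case/andP: (t01 x).
have t1 x : t x <= 1 by case/andP: (t01 x).
pose r x y := P x * P y + Q x * Q y.
pose S x y := b' x y * (t x - t y) ^+ 2.
have S0 x y : 0 <= S x y by rewrite mulr_ge0 ?sqr_ge0.
have EE : E = 2^-1 * \dsum (fun x y =>
    b' x y * (t x ^+ 2 * N x + t y ^+ 2 * N y)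
    - (b x y * t y ^+ 2 + b y x * t x ^+ 2) * r x y).
  transitivity (E + - 2^-1 *
      \dsum (fun x y => b x y * (t x ^+ 2 * N x - t y ^+ 2 * N y))).
    by rewrite K mulr0 addr0.
  rewrite -dsumZ -dsumD.
  rewrite dsum_symmetrize; congr (_ * _); apply: eq_dsum => x y.
  by rewrite /b' /r /N; field.
have rN x y : `|r x y| <= (N x + N y) / 2.
  rewrite ler_norml /N /r; apply/andP; split; rewrite -subr_ge0.
    rewrite (_ : _ - _ = ((P x + P y) ^+ 2 + (Q x + Q y) ^+ 2) / 2); last by field.
    by rewrite divr_ge0// addr_ge0 ?sqr_ge0.
  rewrite (_ : _ - _ = ((P x - P y) ^+ 2 + (Q x - Q y) ^+ 2) / 2); last by field.
  by rewrite divr_ge0// addr_ge0 ?sqr_ge0.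
have bound x y : - (S x y * ((N x + N y) / 2) + (S x y * N y + e x y * N x) / 2)
    <= b' x y * (t x ^+ 2 * N x + t y ^+ 2 * N y)
    - (b x y * t y ^+ 2 + b y x * t x ^+ 2) * r x y.
  (* h1 is the energy of t k, h2 and h4 are the two commutators *)
  have h1 : 0 <= b' x y * (t x ^+ 2 * N x + t y ^+ 2 * N y - 2 * (t x * t y * r x y)).
    rewrite mulr_ge0// (_ : _ - _ =
      (t x * P x - t y * P y) ^+ 2 + (t x * Q x - t y * Q y) ^+ 2).
      by rewrite addr_ge0 ?sqr_ge0.
    by rewrite /N /r; ring.
  have h2 : S x y * r x y <= S x y * ((N x + N y) / 2).
    by rewrite ler_wpM2l// (le_trans (ler_norm _)).
  have h3 : `|(b x y - b y x) * ((t x - t y) * r x y)| <=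
      (S x y * N y + e x y * N x) / 2.
    rewrite /S -(mulrA (b' x y)); apply: asym_am_gm => //.
      by rewrite mulr_ge0 ?sqr_ge0.
    rewrite exprMn -mulrA ler_wpM2l ?sqr_ge0// -subr_ge0 /N /r.
    by rewrite (_ : _ - _ = (P x * Q y - Q x * P y) ^+ 2) ?sqr_ge0//; ring.
  have h4 : `|(b x y - b y x) / 2 * ((t x ^+ 2 - t y ^+ 2) * r x y)| <=
      (S x y * N y + e x y * N x) / 2.
    apply: le_trans h3.
    have -> : (b x y - b y x) / 2 * ((t x ^+ 2 - t y ^+ 2) * r x y) =
      (b x y - b y x) * ((t x - t y) * r x y) * ((t x + t y) / 2) by field.
    rewrite normrM -[leRHS]mulr1 ler_wpM2l//.
    have := t0 x; have := t0 y; have := t1 x; have := t1 y.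
    by move=> *; rewrite ger0_norm; lra.
  move: h4 h1 h2; rewrite ler_norml => /andP[h4 _] h1 h2.
  have -> : b' x y * (t x ^+ 2 * N x + t y ^+ 2 * N y)
    - (b x y * t y ^+ 2 + b y x * t x ^+ 2) * r x y =
    b' x y * (t x ^+ 2 * N x + t y ^+ 2 * N y - 2 * (t x * t y * r x y))
    - S x y * r x y + (b x y - b y x) / 2 * ((t x ^+ 2 - t y ^+ 2) * r x y).
    by rewrite /S /b'; field.
  lra.
have flipS : \dsum (fun x y => S x y * N y) = \dsum (fun x y => S x y * N x).
  rewrite dsum_flip; apply: eq_dsum => x y; congr (_ * _).
  by rewrite /S /b'; field.
have total : \dsum (fun x y =>
    - (S x y * ((N x + N y) / 2) + (S x y * N y + e x y * N x) / 2)) =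
    - (3 / 2) * \dsum (fun x y => S x y * N x)
    + - 2^-1 * \dsum (fun x y => e x y * N x).
  transitivity (\dsum (fun x y => - 2^-1 * (S x y * N x) +
      (-1 * (S x y * N y) + - 2^-1 * (e x y * N x)))).
    by apply: eq_dsum => x y; field.
  by rewrite !dsumD !dsumZ flipS; field.
have Ege : 2^-1 * \dsum (fun x y =>
    - (S x y * ((N x + N y) / 2) + (S x y * N y + e x y * N x) / 2)) <= E.
  by rewrite EE ler_pM2l ?invr_gt0//; exact: ler_dsum.
have SN0 : 0 <= \dsum (fun x y => S x y * N x).
  by apply: dsum_ge0 => x y; rewrite mulr_ge0.
have eN0 : 0 <= \dsum (fun x y => e x y * N x).
  by apply: dsum_ge0 => x y; rewrite mulr_ge0.
have := ler_dsum_row N0 tC; have := ler_dsum_row N0 eC.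
by move: Ege; rewrite total; lra.
Qed.

End double_sums.

(** * The Laplacian of the graph *)

Section graph_laplacian.
Variables (R : realType) (V : countType) (G : wdigraph R V).
Hypothesis Glf : locally_finite G.
Local Notation b := (edge_weight G).
Local Notation m := (vertex_weight G).
Local Notation nrm := (hnorm (l2_dot G)).
Implicit Types (f g h : l2 G) (s : seq V).

(** A finite set containing D and all its neighbours: both Delta f and the
    Kirchhoff sums of a function supported in D live on the square s x s. *)
Definition collar (D : set V) s : Prop :=
  uniq s /\ forall x, D x -> x \in s /\ forall y, Defs.adjacent G x y -> y \in s.

Lemma collar_exists (D : set V) : finite_set D -> exists s, collar D s.
Proof.
move=> fD; have fN : finite_set (D `|` \bigcup_(x in D) neighbors G x).
  by rewrite finite_setU; split=> //; apply: bigcup_finite => // x _; exact: Glf.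
exists (finmap.enum_fset (fset_set (D `|` \bigcup_(x in D) neighbors G x))).
split=> [|x Dx]; first exact: finmap.fset_uniq.
by split=> [|y xy]; rewrite in_fset_set// inE; [left|right; exists x].
Qed.

Lemma edge_weight_eq0 x y : ~~ Defs.adjacent G x y -> b x y = 0 /\ b y x = 0.
Proof.
rewrite negb_or !lt_def !edge_weight_ge0 !andbT !negbK.
by move=> /andP[/eqP-> /eqP->].
Qed.

Lemma adjacent_sym x y : Defs.adjacent G x y = Defs.adjacent G y x.
Proof. exact: orbC. Qed.

Lemma laplacian_fun_seq (u : V -> R[i]) x s : uniq s ->
  (forall y, Defs.adjacent G x y -> y \in s) ->
  laplacian_fun G u x =
    ((m x)^-1)%:C%C * \sum_(y <- s) (b x y)%:C%C * (u x - u y).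
Proof.
move=> us xs; congr (_ * _); apply: fsbigT_seq => // y ys.
by rewrite (edge_weight_eq0 _).1 ?mul0r//; apply: contra ys; exact: xs.
Qed.

Lemma laplacian_fun_collar (u : V -> R[i]) s x : collar [set x | u x != 0] s ->
  x \in s -> laplacian_fun G u x =
    ((m x)^-1)%:C%C * \sum_(y <- s) (b x y)%:C%C * (u x - u y).
Proof.
move=> [us uP] xs; congr (_ * _); apply: fsbigT_seq => // y ys.
have -> : u y = 0 by apply/eqP; apply: contraNT ys => uy; exact: (uP y uy).1.
rewrite subr0; have [->|ux] := eqVneq (u x) 0; first by rewrite mulr0.
rewrite (edge_weight_eq0 _).1 ?mul0r//.
by apply: contra ys; exact: (uP x ux).2.
Qed.

Lemma laplacian_fun_off_collar (u : V -> R[i]) s x :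
  collar [set x | u x != 0] s -> x \notin s -> laplacian_fun G u x = 0.
Proof.
move=> [us uP] xs; rewrite /laplacian_fun fsbig1 ?mulr0// => y _.
have -> : u x = 0 by apply/eqP; apply: contraNT xs => ux; exact: (uP x ux).1.
have [->|uy] := eqVneq (u y) 0; first by rewrite subr0 mulr0.
rewrite (edge_weight_eq0 _).1 ?mul0r//.
by rewrite adjacent_sym; apply: contra xs; exact: (uP y uy).2.
Qed.

Lemma Re_sum (T : Type) (r : seq T) (F : T -> R[i]) :
  complex.Re (\sum_(x <- r) F x) = \sum_(x <- r) complex.Re (F x).
Proof. exact: (big_morph _ (@ReCD R)). Qed.

Lemma Im_sum (T : Type) (r : seq T) (F : T -> R[i]) :
  complex.Im (\sum_(x <- r) F x) = \sum_(x <- r) complex.Im (F x).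
Proof. exact: (big_morph _ (@ImCD R)). Qed.

Lemma Re_laplacian_fun (u : V -> R[i]) x s :
  complex.Re (((m x)^-1)%:C%C * \sum_(y <- s) (b x y)%:C%C * (u x - u y)) =
  (m x)^-1 * \sum_(y <- s) b x y * (complex.Re (u x) - complex.Re (u y)).
Proof.
rewrite ReCM /= mul0r subr0 Re_sum; congr (_ * _); apply: eq_bigr => y _.
by rewrite ReCM ReCD ReCN /= mul0r subr0.
Qed.

Lemma Im_laplacian_fun (u : V -> R[i]) x s :
  complex.Im (((m x)^-1)%:C%C * \sum_(y <- s) (b x y)%:C%C * (u x - u y)) =
  (m x)^-1 * \sum_(y <- s) b x y * (complex.Im (u x) - complex.Im (u y)).
Proof.
rewrite ImCM /= mul0r addr0 Im_sum; congr (_ * _); apply: eq_bigr => y _.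
by rewrite ImCM ImCD ImCN /= mul0r addr0.
Qed.

Lemma laplacian_operator : is_operator (laplacian G).
Proof.
split.
- split; first by rewrite /finitely_supported /= (_ : [set _ | _] = set0)//;
    apply/seteqP; split=> // x /=; rewrite eqxx.
  apply/funext => x; rewrite /laplacian_fun fsbig1 ?mulr0// => y _.
  by rewrite subrr mulr0.
- move=> z [f f'] [g g'] [/= fS f'E] [/= gS g'E]; split=> /=.
    apply: (@sub_finite_set _ _ ([set x | f x != 0] `|` [set x | g x != 0])).
      move=> x /= zx; apply: contrapT => /not_orP[].
      move=> /negP/negPn/eqP fx /negP/negPn/eqP gx; move/eqP: zx; apply.
      by rewrite -[LHS]/(z * f x + g x) fx gx mulr0 addr0.
    by rewrite finite_setU.
  apply/funext => x; rewrite -[LHS]/(z * f' x + g' x) f'E g'E.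
  have [s [us /(_ x erefl)[_ sP]]] := collar_exists (finite_set1 x).
  rewrite !(laplacian_fun_seq _ us sP) mulrCA -mulrDr; congr (_ * _).
  rewrite mulr_sumr -big_split; apply: eq_bigr => y _ /=.
  rewrite -[X in _ = _ * (X - _)]/(z * f x + g x).
  rewrite -[X in _ = _ * (_ - X)]/(z * f y + g y); ring.
- move=> f g h [/= _ gE] [/= _ hE]; apply/val_inj => /=.
  by rewrite gE hE.
Qed.

(** Delta f at x depends on finitely many values of f, so the pointwise formula
    survives l2 limits. *)
Lemma op_closure_laplacian f g :
  op_closure (l2_dot G) (laplacian G) (f, g) ->
  (g : V -> R[i]) = laplacian_fun G f.
Proof.
move=> [u [uL /= uf ug]]; apply/funext => x.
have [s [us /(_ x erefl)[_ sP]]] := collar_exists (finite_set1 x).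
have uE n : (u n).2 x =
    ((m x)^-1)%:C%C * \sum_(y <- s) (b x y)%:C%C * ((u n).1 x - (u n).1 y).
  by rewrite (uL n).2 (laplacian_fun_seq _ us sP).
rewrite (laplacian_fun_seq _ us sP); apply/eqP; rewrite eq_complex.
rewrite Re_laplacian_fun Im_laplacian_fun.
have pt y := hcvg_pointwise y uf.
have [gR gI] := hcvg_pointwise x ug.
apply/andP; split; apply/eqP.
- apply: (norm_cvg_unique gR) => /=; under eq_fun do rewrite uE Re_laplacian_fun.
  apply: cvgM; first exact: cvg_cst.
  apply: cvg_sum_seq => y; apply: cvgM; first exact: cvg_cst.
  by apply: cvgB; [exact: (pt x).1|exact: (pt y).1].
- apply: (norm_cvg_unique gI) => /=; under eq_fun do rewrite uE Im_laplacian_fun.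
  apply: cvgM; first exact: cvg_cst.
  apply: cvg_sum_seq => y; apply: cvgM; first exact: cvg_cst.
  by apply: cvgB; [exact: (pt x).2|exact: (pt y).2].
Qed.

Lemma op_closure_laplacian_operator :
  is_operator (op_closure (l2_dot G) (laplacian G)).
Proof.
apply: op_closure_operator; first exact: laplacian_operator.
move=> f g h /op_closure_laplacian gE /op_closure_laplacian hE.
by apply/val_inj => /=; rewrite gE hE.
Qed.

Lemma laplacian_dot f g h s : laplacian G (f, g) ->
  collar [set x | f x != 0] s ->
  complex.Re (l2_dot G g h) = \sum_(x <- s) \sum_(y <- s) b x y *
    ((complex.Re (f x) - complex.Re (f y)) * complex.Re (h x) +
     (complex.Im (f x) - complex.Im (f y)) * complex.Im (h x)) /\
  complex.Im (l2_dot G g h) = \sum_(x <- s) \sum_(y <- s) b x y *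
    ((complex.Im (f x) - complex.Im (f y)) * complex.Re (h x) -
     (complex.Re (f x) - complex.Re (f y)) * complex.Im (h x)).
Proof.
move=> [_ gE] fs; have us := fs.1.
have gx x : g x = laplacian_fun G f x := congr1 (@^~ x) gE.
rewrite (@l2_dot_seq _ _ _ _ _ s)//; last first.
  by move=> x xs; rewrite gx; exact: (laplacian_fun_off_collar fs xs).
rewrite /=; split; apply: eq_big_seq => x xs;
  rewrite gx (laplacian_fun_collar fs xs) Re_laplacian_fun Im_laplacian_fun;
  rewrite ?mulrBr ?mulrDr -!mulrA !(mulrA (m x)) mulfV;
  rewrite ?mul1r ?gt_eqF ?vertex_weight_gt0//.
- rewrite !mulr_suml -big_split; apply: eq_bigr => y _ /=; ring.
- rewrite !mulr_suml -sumrB; apply: eq_bigr => y _ /=; ring.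
Qed.

(** Kirchhoff's law in weak form: inflow and outflow balance against any finitely
    supported phi. *)
Lemma kirchhoff_dsum (phi : V -> R) s : kirchhoff G ->
  collar [set x | phi x != 0] s ->
  \sum_(x <- s) \sum_(y <- s) b x y * (phi x - phi y) = 0.
Proof.
move=> GK [us sP].
transitivity (\sum_(x <- s) \sum_(y <- s) b x y * phi x -
  \sum_(x <- s) \sum_(y <- s) b x y * phi y).
  rewrite -sumrB; apply: eq_bigr => x _; rewrite -sumrB.
  by apply: eq_bigr => y _; rewrite mulrBr.
rewrite [X in _ - X]exchange_big -sumrB big1// => x _ /=.
rewrite -!mulr_suml -mulrBl.
have [->|px] := eqVneq (phi x) 0; first by rewrite mulr0.
have [_ xP] := sP x px.
have off y : y \notin s -> b x y = 0 /\ b y x = 0.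
  by move=> ys; apply: edge_weight_eq0; apply: contra ys; exact: xP.
rewrite -!(fsbigT_seq us); [|by move=> y /off[]..].
by rewrite GK subrr mul0r.
Qed.

Lemma ler_sum_neighbors (F : V -> R) x s : uniq s -> (forall y, 0 <= F y) ->
  (forall y, ~~ Defs.adjacent G x y -> F y = 0) ->
  \sum_(y <- s) F y <= \sum_(y \in neighbors G x) F y.
Proof.
move=> us F0 Fx; have fN := Glf x.
pose r := undup (s ++ finmap.enum_fset (fset_set (neighbors G x))).
have ur : uniq r := undup_uniq _.
have -> : \sum_(y \in neighbors G x) F y = \sum_(y <- r) F y.
  rewrite [RHS]fsbig_seq//; apply: fsbig_widen => y.
    by move=> xy; rewrite /= mem_undup mem_cat in_fset_set// mem_set ?orbT.
  by move=> [_ /= /negP]; exact: Fx.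
by apply: ler_sum_subset => // y ys; rewrite mem_undup mem_cat ys.
Qed.

Definition asym_ratio x y : R := `|b x y - b y x| ^+ 2 / sym_weight G x y.

Lemma sym_weight_ge0 x y : 0 <= sym_weight G x y.
Proof. by rewrite divr_ge0 ?addr_ge0 ?edge_weight_ge0. Qed.

Lemma asym_ratio_ge0 x y : 0 <= asym_ratio x y.
Proof. by rewrite divr_ge0 ?sqr_ge0 ?sym_weight_ge0. Qed.

Lemma asym_ratioM x y :
  asym_ratio x y * ((b x y + b y x) / 2) = (b x y - b y x) ^+ 2.
Proof.
rewrite -[_ / 2]/(sym_weight G x y) /asym_ratio real_normK ?num_real//.
have [sw|sw] := eqVneq (sym_weight G x y) 0; last by rewrite divfK.
(* if b'(x,y) = 0 then b(x,y) = b(y,x) = 0, and both sides vanish *)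
rewrite sw mulr0; have := edge_weight_ge0 G x y; have := edge_weight_ge0 G y x.
move: sw; rewrite /sym_weight => sw byx bxy.
have -> : b x y = 0 by lra.
have -> : b y x = 0 by lra.
by rewrite subrr expr0n.
Qed.

Lemma row_sum_le (F : V -> R) (C : R) s x : uniq s -> (forall y, 0 <= F y) ->
  (forall y, ~~ Defs.adjacent G x y -> F y = 0) ->
  (m x)^-1 * \sum_(y \in neighbors G x) F y <= C ->
  \sum_(y <- s) F y <= C * m x.
Proof.
move=> us F0 Fx FC; rewrite -ler_pdivrMr ?vertex_weight_gt0// mulrC.
apply: le_trans FC; rewrite ler_pM2l ?invr_gt0 ?vertex_weight_gt0//.
exact: ler_sum_neighbors.
Qed.

Lemma asym_row_le (C : R) s x : uniq s ->
  (m x)^-1 * \sum_(y \in neighbors G x) asym_ratio x y <= C ->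
  \sum_(y <- s) asym_ratio x y <= C * m x.
Proof.
move=> us; apply: row_sum_le => // [y|y xy]; first exact: asym_ratio_ge0.
have [b1 b2] := edge_weight_eq0 xy.
by rewrite /asym_ratio b1 b2 subrr normr0 expr0n mul0r.
Qed.

Lemma cutoff_row_le (t : V -> R) (C : R) s x : uniq s ->
  (m x)^-1 * \sum_(y \in neighbors G x)
    sym_weight G x y * `|t x - t y| ^+ 2 <= C ->
  \sum_(y <- s) (b x y + b y x) / 2 * (t x - t y) ^+ 2 <= C * m x.
Proof.
move=> us.
under [in X in _ -> X]eq_bigr do
  rewrite -[_ / 2]/(sym_weight G _ _) -real_normK ?num_real//.
apply: row_sum_le => // [y|y xy]; first by rewrite mulr_ge0 ?sym_weight_ge0.
have [b1 b2] := edge_weight_eq0 xy.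
by rewrite /sym_weight b1 b2 addr0 !mul0r.
Qed.

Lemma laplacian_sector (C2 : R) f g : kirchhoff G ->
  (forall x, (m x)^-1 * \sum_(y \in neighbors G x) asym_ratio x y <= C2) ->
  0 <= C2 -> laplacian G (f, g) ->
  `|complex.Im (l2_dot G g f)| <= complex.Re (l2_dot G g f) + C2 * nrm f ^+ 2.
Proof.
move=> GK asym C20 Lfg.
have [s fs] := collar_exists Lfg.1.
have [-> ->] := laplacian_dot f Lfg fs.
pose N x := complex.Re (f x) ^+ 2 + complex.Im (f x) ^+ 2.
have K : \sum_(x <- s) \sum_(y <- s) b x y * (N x - N y) = 0.
  apply: kirchhoff_dsum => //; split; first exact: fs.1.
  move=> x Nx; apply: fs.2; apply: contra Nx => /eqP fx.
  by rewrite /N fx /= expr0n addr0.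
apply: le_trans (sector_dsum (edge_weight_ge0 G) asym_ratio_ge0 asym_ratioM
  (fun x => asym_row_le fs.1 (asym x)) K) _.
by rewrite lerD2l ler_wpM2l// l2_sum_le//; exact: fs.1.
Qed.

(** The test function t^2 k turns orthogonality into
    Re z |t k|^2 = - Re <Delta (t^2 k), k>, to which the cut-off estimate
    applies; the set r stands for a part of V on which the cut-off is 1. *)
Lemma orthogonal_mass_bound (C1 C2 : R) (t : V -> R) (z : R[i]) (k : l2 G)
    (r : seq V) : kirchhoff G ->
  (forall x, (m x)^-1 * \sum_(y \in neighbors G x) asym_ratio x y <= C2) ->
  finitely_supported t -> (forall x, 0 <= t x <= 1) ->
  (forall x, (m x)^-1 * \sum_(y \in neighbors G x)
     sym_weight G x y * `|t x - t y| ^+ 2 <= C1) ->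
  0 <= C1 + C2 -> 0 < complex.Re z ->
  (forall f g, laplacian G (f, g) ->
     complex.Re (l2_dot G (g + z *: f) k) = 0) ->
  uniq r -> (forall x, x \in r -> t x = 1) ->
  complex.Re z * \sum_(x <- r) m x * sqr_mod (k x) <=
  (C1 + C2) * nrm k ^+ 2.
Proof.
move=> GK asym tfin t01 tC C0 z0 kperp ur rt.
pose N x := complex.Re (k x) ^+ 2 + complex.Im (k x) ^+ 2.
pose u x : R[i] := (t x ^+ 2)%:C%C * k x.
have ut x : u x != 0 -> t x != 0.
  by apply: contra => /eqP tx; rewrite /u tx expr0n mul0r.
have uS : finitely_supported u by apply: sub_finite_set tfin => x; exact: ut.
pose f : l2 G := L2 (finitely_supported_l2 G uS).
have [g Lfg] : op_dom (laplacian G) f by rewrite laplacian_dom.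
have [s [us sP]] := collar_exists tfin.
have fs : collar [set x | f x != 0] s.
  by split=> // x fx; apply: sP; exact: ut.
have K : \sum_(x <- s) \sum_(y <- s)
    b x y * (t x ^+ 2 * N x - t y ^+ 2 * N y) = 0.
  apply: (@kirchhoff_dsum (fun x => t x ^+ 2 * N x)) => //.
  split=> // x Nx; apply: sP.
  by apply: contra Nx => /eqP tx; rewrite tx expr0n mul0r.
have lower := cutoff_dsum (edge_weight_ge0 G) asym_ratio_ge0 asym_ratioM
  (fun x => asym_row_le us (asym x)) t01 (fun x => cutoff_row_le us (tC x)) K.
have Ref x : complex.Re (f x) = t x ^+ 2 * complex.Re (k x).
  by rewrite ReCM /= mul0r subr0.
have Imf x : complex.Im (f x) = t x ^+ 2 * complex.Im (k x).
  by rewrite ImCM /= mul0r addr0.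
have fkE : l2_dot G f k = (\sum_(x <- s) m x * (t x ^+ 2 * N x))%:C%C.
  rewrite (@l2_dot_seq _ _ _ _ _ s)//; last first.
    move=> x xs; apply/eqP; apply: contraNT xs => fx.
    exact: (fs.2 x fx).1.
  apply/eqP; rewrite eq_complex /=; apply/andP; split; apply/eqP.
    by apply: eq_bigr => x _; congr (_ * _); rewrite Ref Imf /N; ring.
  by rewrite big1// => x _; rewrite Ref Imf; ring.
have [gkE _] := laplacian_dot k Lfg fs.
have dotE : l2_dot G (g + z *: f) k = l2_dot G g k + z * l2_dot G f k.
  by rewrite [LHS]linearDl; congr (_ + _); rewrite [LHS]linearZl_LR.
have := kperp f g Lfg.
rewrite dotE ReCD ReCM gkE fkE /= mulr0 subr0.
under eq_bigr do under eq_bigr do rewrite !Ref !Imf.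
move=> /eqP; rewrite addrC addr_eq0 => /eqP zE.
have rs : \sum_(x <- r) m x * sqr_mod (k x) <=
    \sum_(x <- s) m x * (t x ^+ 2 * N x).
  have -> : \sum_(x <- r) m x * sqr_mod (k x) =
      \sum_(x <- r) m x * (t x ^+ 2 * N x).
    by apply: eq_big_seq => x /rt ->; rewrite expr1n mul1r.
  apply: ler_sum_subset => // [x xr|x].
    by apply: (sP x _).1; rewrite /= rt ?oner_eq0.
  apply: mulr_ge0; first exact/ltW/vertex_weight_gt0.
  by rewrite mulr_ge0 ?addr_ge0 ?sqr_ge0.
have /le_trans -> // : complex.Re z * (\sum_(x <- r) m x * sqr_mod (k x)) <=
    complex.Re z * (\sum_(x <- s) m x * (t x ^+ 2 * N x)).
  by rewrite ler_pM2l.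
rewrite zE lerNl; apply: le_trans lower.
by rewrite lerN2 ler_wpM2l//; exact: l2_sum_le.
Qed.

End graph_laplacian.

(** * The closure of the Laplacian is m-sectorial *)

Theorem proposition4p3 (R : realType) (V : countType) (G : wdigraph R V)
  (Glf : locally_finite G)
  (Gconn : weakly_connected G)
  (Gpos : positive_outdegree G)
  (Gkirchhoff : kirchhoff G)
  (Gchi : chi_complete G (sym_weight G))
  (Gasym : exists2 C : R, 0 < C & forall x : V,
     (vertex_weight G x)^-1 * \sum_(y \in neighbors G x)
       (`|edge_weight G x y - edge_weight G y x| ^+ 2 / sym_weight G x y) <= C) :
  m_sectorial (l2_dot G) (op_closure (l2_dot G) (laplacian G)).
Proof.
have [C2 C20 asym] := Gasym.
have [B [chi [[_ Bincr Bcover] [chifin chi01 chiB [C1 C10 chiC]]]]] := Gchi.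
have C0 : 0 < C1 + C2 by rewrite addr_gt0.
apply: (@m_sectorial_closure _ _ _ _ (C1 + C2)).
- exact: l2_complete.
- exact: laplacian_operator.
- exact: op_closure_laplacian_operator.
- move=> f g Lfg.
  apply: le_trans (laplacian_sector Glf Gkirchhoff asym (ltW C20) Lfg) _.
  by rewrite lerD2l ler_wpM2r ?sqr_ge0// lerDr ltW.
- move=> z k zC kperp.
  have z0 : 0 < complex.Re z := lt_trans C0 zC.
  have bound r : uniq r -> \sum_(x <- r) vertex_weight G x * sqr_mod (k x) <=
      (C1 + C2) * hnorm (l2_dot G) k ^+ 2 / complex.Re z.
    move=> ur; have [n rB] := finite_sub_exhaustion r Bincr Bcover.
    rewrite ler_pdivlMr// mulrC.
    apply: (orthogonal_mass_bound Glf Gkirchhoff asym (chifin n) (chi01 n)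
      (chiC n) (ltW C0) z0 kperp ur) => x xr.
    exact/chiB/rB.
  have := sqr_hnorm_le bound.
  rewrite ler_pdivlMr// mulrC -subr_ge0 -mulrBl nmulr_rge0 ?subr_lt0// => k0.
  apply: (@hnorm_eq0 _ _ (l2_dot G)); apply/eqP.
  by rewrite -sqrf_eq0 eq_le k0 sqr_ge0.
Qed.
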